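(* Let $0<\alpha\le n$, let $F\subset\mathbb{R}^n$ be an $\alpha$-set, and let $T:F\to T(F)\subset\mathbb{R}^n$ be a bi-Lipschitz transform. Let $\beta_1^\ast$ and $\beta_2^\ast$ be the critical exponents of $(F,d,\mu)$ and $(T(F),d,\mu)$ respectively, where $d$ is the Euclidean metric and $\mu$ is the $\alpha$-dimensional Hausdorff measure (restricted to $F$, respectively to $T(F)$). Then $\beta_1^\ast=\beta_2^\ast$.
   Context: **Bi-Lipschitz transforms.** A map $T:(X,d_1)\to(Y,d_2)$ between metric spaces is a bi-Lipschitz transform if it is a bijection and there is a constant $C>0$ such that $C^{-1}d_1(x,y)\le d_2(Tx,Ty)\le C\,d_1(x,y)$ for all $x,y\in X$. **$\alpha$-sets.** Let $F\subset\mathbb{R}^n$ be a closed set and $0<\alpha\le n$. $F$ is called an $\alpha$-set if there is a Borel measure $\nu$ on $F$ (an Ahlfors regular measure) and a constant $C>0$ such that $C^{-1}r^\alpha\le\nu(B(x,r))\le Cr^\alpha$ for all $x\in F$ and all $0<r<1$, where $B(x,r)$ is the Euclidean ball. It is known that such a $\nu$ is then equivalent to the $\alpha$-dimensional Hausdorff measure on $F$. **Metric measure spaces.** A metric measure space $(M,d,\mu)$ is a locally compact separable metric space $(M,d)$ with a Radon measure $\mu$ of full support. Write $B(x,r)$ for the metric ball in $M$ with center $x$ and radius $r$, and $V(x,r):=\mu(B(x,r))$. **Besov spaces.** For $\sigma>0$ and a measurable function $u$ on $M$ put $$W_{\sigma,M}(u):=\sup_{0<r<1}r^{-2\sigma}\int_M\left[\frac{1}{V(x,r)}\int_{B(x,r)}|u(x)-u(y)|^2\,d\mu(y)\right]d\mu(x),$$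 and $W^{\sigma,2}=W^{\sigma,2}(M,d,\mu):=\{u\in L^2(M,\mu): W_{\sigma,M}(u)<\infty\}$. **Critical exponent.** The critical exponent of $(M,d,\mu)$ is $$\beta^\ast:=2\sup\{\sigma>0: W^{\sigma,2}(M,d,\mu)\text{ contains non-constant functions}\},$$ where functions are understood as elements of $L^2(M,\mu)$ (so non-constant means not $\mu$-a.e. equal to a constant), and the value $+\infty$ is allowed. *)

(* Defs.v *)
From HB Require Import structures.
From mathcomp Require Import all_boot all_order all_algebra.
From mathcomp Require Import all_classical all_reals all_analysis.
From mathcomp Require Import ring lra zify.

Set Implicit Arguments.
Unset Strict Implicit.
Unset Printing Implicit Defensive.

Import Order.TTheory GRing.Theory Num.Theory.
Import numFieldNormedType.Exports.

Local Open Scope classical_set_scope.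
Local Open Scope ring_scope.

#[short(type="pmetricType")]
HB.structure Definition PointedMetric (K : numDomainType) :=
  { M of Metric K M & isPointed M }.

(* 'rV[R]_n carries the sup norm in the library; this alias carries the
   Euclidean metric, with the topology and balls that it induces. *)
Definition euclidean (R : realType) (n : nat) : Type := 'rV[R]_n.

Section euclidean_metric.
Context {R : realType} {n : nat}.
Implicit Types x y z : 'rV[R]_n.

Definition edist x y : R := Num.sqrt (\sum_(i < n) (x ord0 i - y ord0 i) ^+ 2).

Let sumsq_ge0 (a : 'I_n -> R) : 0 <= \sum_(i < n) a i ^+ 2.
Proof. by apply: sumr_ge0 => i _; rewrite sqr_ge0. Qed.

Lemma sum_cauchy_schwarz (a b : 'I_n -> R) :
  (\sum_i a i * b i) ^+ 2 <= (\sum_i a i ^+ 2) * (\sum_i b i ^+ 2).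
Proof.
have : 0 <= \sum_i \sum_j (a i * b j - a j * b i) ^+ 2.
  by apply: sumr_ge0 => i _; apply: sumr_ge0 => j _; rewrite sqr_ge0.
have -> : \sum_i \sum_j (a i * b j - a j * b i) ^+ 2 =
    ((\sum_i a i ^+ 2) * (\sum_i b i ^+ 2) - (\sum_i a i * b i) ^+ 2) *+ 2.
  rewrite mulrnBl mulr2n {2}[_ * _]mulrC expr2 !big_distrlr /=.
  rewrite -[X in _ - X]sumrMnl -!big_split/= -sumrB.
  apply: eq_bigr => i _.
  rewrite -sumrMnl -!big_split/= -sumrB.
  by apply: eq_bigr => j _; ring.
by rewrite pmulrn_lge0// subr_ge0.
Qed.

Lemma edistxx x : edist x x = 0.
Proof.
by rewrite /edist big1 ?sqrtr0// => i _; rewrite subrr expr0n.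
Qed.

Lemma edist_positivity x y : edist x y = 0 -> x = y.
Proof.
move=> /eqP; rewrite sqrtr_eq0 => s0; apply/rowP => i; apply/eqP.
rewrite -subr_eq0 -sqrf_eq0 eq_le sqr_ge0 andbT (le_trans _ s0)//.
by rewrite (bigD1 i)//= lerDl sumr_ge0// => j _; rewrite sqr_ge0.
Qed.

Lemma edist_sym x y : edist x y = edist y x.
Proof. by congr Num.sqrt; apply: eq_bigr => i _; rewrite -sqrrN opprB. Qed.

Lemma edist_triangle y x z : edist x z <= edist x y + edist y z.
Proof.
rewrite -(@ler_pXn2r _ 2%N)// ?nnegrE ?addr_ge0 ?sqrtr_ge0//.
rewrite sqrrD !sqr_sqrtr ?sumsq_ge0//.
pose a i := x ord0 i - y ord0 i; pose b i := y ord0 i - z ord0 i.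
have -> : \sum_(i < n) (x ord0 i - z ord0 i) ^+ 2 =
    \sum_i a i ^+ 2 + (\sum_i a i * b i) *+ 2 + \sum_i b i ^+ 2.
  rewrite -sumrMnl -!big_split/=; apply: eq_bigr => i _.
  by rewrite -sqrrD /a /b subrKA.
rewrite lerD2r lerD2l lerMn2r/= -sqrtrM ?sumsq_ge0//.
by rewrite (le_trans (ler_norm _))// -sqrtr_sqr ler_wsqrtr// sum_cauchy_schwarz.
Qed.

End euclidean_metric.

HB.instance Definition _ (R : realType) n := Choice.copy (euclidean R n) 'rV[R]_n.
HB.instance Definition _ (R : realType) n := isPointed.Build (euclidean R n) 0.
HB.instance Definition _ (R : realType) n := isMetric.Build R (euclidean R n)
  (@edistxx R n) (@edist_positivity R n) (@edist_sym R n) (@edist_triangle R n).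

Definition borel (R : realType) (T : pmetricType R) : Type :=
  g_sigma_algebraType (@open T).
HB.instance Definition _ (R : realType) (T : pmetricType R) :=
  Measurable.on (borel T).

Section hausdorff.
Local Open Scope ereal_scope.
Context {R : realType} {T : pmetricType R}.
Implicit Types (a delta : R) (A B X : set T).

(* diam set0 = -oo *)
Definition diam A : \bar R :=
  ereal_sup [set (mdist x y)%:E | x in A & y in A].

(* The empty set contributes 0 for every exponent, and no normalizing constant
   is put in front of the power of the diameter. *)
Definition diam_pow a A : \bar R := if A == set0 then 0 else (diam A) `^ a.

Definition delta_cover delta A := [set U : (set T)^nat |
  (forall k, diam (U k) <= delta%:E) /\ A `<=` \bigcup_k U k].

Definition hausdorff_delta a delta A : \bar R :=
  ereal_inf [set \sum_(k <oo) diam_pow a (U k) | U in delta_cover delta A].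

Definition hausdorff_measure a : set (borel T) -> \bar R := fun A : set T =>
  ereal_sup [set hausdorff_delta a delta A | delta in [set delta : R | (0 < delta)%R]].

Lemma diam_pow_ge0 a A : 0 <= diam_pow a A.
Proof. by rewrite /diam_pow; case: ifP => // _; exact: poweR_ge0. Qed.

Lemma diam_pow0 a : diam_pow a set0 = 0.
Proof. by rewrite /diam_pow eqxx. Qed.

Lemma diam0 : diam set0 = -oo.
Proof.
rewrite /diam (_ : [set _ | _ in _ & _ in _] = set0) ?ereal_sup0//.
by rewrite -subset0 => r [x].
Qed.

Lemma le_mdist_diam A x y : A x -> A y -> (mdist x y)%:E <= diam A.
Proof. by move=> Ax Ay; apply: ereal_sup_ubound; exists x => //; exists y. Qed.

Let dcost a delta A := if diam A <= delta%:E then diam_pow a A else +oo.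

Let dcost_ge0 a delta A : 0 <= dcost a delta A.
Proof. by rewrite /dcost; case: ifP => // _; exact: diam_pow_ge0. Qed.

Let dcost0 a delta : dcost a delta set0 = 0.
Proof. by rewrite /dcost diam0 leNye diam_pow0. Qed.

Let hausdorff_deltaE a delta : hausdorff_delta a delta =
  mu_ext (dcost a delta : set (g_sigma_algebraType [set: set T]) -> \bar R).
Proof.
apply/funext => A; apply/eqP; rewrite eq_le; apply/andP; split.
- apply: le_ereal_inf_tmp => _ [U [mU AU] <-].
  have [dU|] := pselect (forall k, diam (U k) <= delta%:E).
    apply: ereal_inf_lbound; exists U => //.
    by apply: eq_eseriesr => k _; rewrite /dcost dU.
  move=> /existsNP[k /negP dk].
  rewrite [leRHS](@eseries_pinfty _ _ _ k) ?leey//.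
    by move=> i _; rewrite gt_eqF// (lt_le_trans _ (dcost_ge0 _ _ _)).
  by rewrite /dcost (negbTE dk).
- apply: le_ereal_inf_tmp => _ [U [dU AU] <-].
  apply: ereal_inf_lbound; exists U; first by split=> // k; exact: sub_sigma_algebra.
  by apply: eq_eseriesr => k _; rewrite /dcost dU.
Qed.

Lemma hausdorff_delta0 a delta : hausdorff_delta a delta set0 = 0.
Proof. by rewrite hausdorff_deltaE mu_ext0. Qed.

Lemma hausdorff_delta_ge0 a delta A : 0 <= hausdorff_delta a delta A.
Proof. by rewrite hausdorff_deltaE mu_ext_ge0. Qed.

Lemma le_hausdorff_delta a delta A B :
  A `<=` B -> hausdorff_delta a delta A <= hausdorff_delta a delta B.
Proof. by move=> AB; rewrite hausdorff_deltaE; exact: le_mu_ext. Qed.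

Lemma hausdorff_delta_sigma_subadditive a delta :
  sigma_subadditive (hausdorff_delta a delta).
Proof.
rewrite hausdorff_deltaE.
exact: (@mu_ext_sigma_subadditive _ (g_sigma_algebraType [set: set T]) R _ (@dcost_ge0 a delta)).
Qed.

Lemma le_hausdorff_measure_delta a delta A : (0 < delta)%R ->
  hausdorff_delta a delta A <= hausdorff_measure a A.
Proof. by move=> d0; apply: ereal_sup_ubound; exists delta. Qed.

Let hausdorff_measure0 a : hausdorff_measure a set0 = 0.
Proof.
apply/eqP; rewrite eq_le; apply/andP; split.
  by apply: ge_ereal_sup => _ [d _ <-]; rewrite hausdorff_delta0.
by rewrite (le_trans _ (le_hausdorff_measure_delta _ _ ltr01))//
  hausdorff_delta_ge0.
Qed.

Let hausdorff_measure_ge0 a A : 0 <= hausdorff_measure a A.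
Proof.
by rewrite (le_trans _ (le_hausdorff_measure_delta _ _ ltr01))//
  hausdorff_delta_ge0.
Qed.

Let le_hausdorff_measure a :
  {homo hausdorff_measure a : A B / A `<=` B >-> A <= B}.
Proof.
move=> A B AB; apply: ge_ereal_sup => _ [d d0 <-].
by rewrite (le_trans (le_hausdorff_delta _ _ AB))// le_hausdorff_measure_delta.
Qed.

Let hausdorff_measure_sigma_subadditive a :
  sigma_subadditive (hausdorff_measure a).
Proof.
move=> F; apply: ge_ereal_sup => _ [d d0 <-].
rewrite (le_trans (hausdorff_delta_sigma_subadditive _ _ _))//.
apply: lee_nneseries => [i _ _|i _]; first exact: hausdorff_delta_ge0.
exact: le_hausdorff_measure_delta.
Qed.

HB.instance Definition _ a := isOuterMeasure.Build R (borel T)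
  (hausdorff_measure a) (hausdorff_measure0 a) (hausdorff_measure_ge0 a)
  (@le_hausdorff_measure a) (@hausdorff_measure_sigma_subadditive a).

End hausdorff.

Section metric_outer_measure.
Local Open Scope ereal_scope.
Context {R : realType} {T : metricType R}.
Variable mu : {outer_measure set T -> \bar R}.

Definition metric_separated (A B : set T) := exists2 e : R, (0 < e)%R &
  forall x y, A x -> B y -> (e <= mdist x y)%R.

Hypothesis mu_separated : forall A B, metric_separated A B ->
  mu A + mu B <= mu (A `|` B).

Variables (X G : set T).
Hypotheses (Xoo : mu X < +oo) (oG : open G).

Let XG n := X `&` G `&` [set x | ball x (n.+1%:R^-1 : R) `<=` G].

Let D n := XG n.+1 `\` XG n.

Let le_XG m n : (m <= n)%N -> XG m `<=` XG n.
Proof.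
move=> mn x [XGx xG]; split => //; apply: subset_trans xG.
by apply: le_ball; rewrite lef_pV2 ?posrE// ler_nat.
Qed.

Let bigcup_XG : X `&` G = \bigcup_n XG n.
Proof.
apply/seteqP; split => [x [Xx Gx]|x [n _ []]//].
have /nbhs_ballP[_/posnumP[e] xeG] : nbhs x G by exact: open_nbhs_nbhs.
near \oo => n; exists n => //; split => //=; apply: subset_trans xeG.
by apply: le_ball; apply: ltW; near: n; exact: near_infty_natSinv_lt.
Unshelve. all: by end_near. Qed.

Let separated_XG_C n : metric_separated (XG n) (X `&` ~` G).
Proof.
exists n.+1%:R^-1%R => [//|x y [_ xG] [_ Gy]].
by rewrite leNgt; apply/negP => xy; apply: Gy; apply: xG; rewrite ballEmdist.
Qed.

Let separated_XG n : metric_separated (XG n) (X `&` G `\` XG n.+1).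
Proof.
exists (n.+1%:R^-1 - n.+2%:R^-1)%R.
  by rewrite subr_gt0 ltf_pV2 ?posrE// ltr_nat.
move=> x y [_ xG] [XGy nXGy]; have /existsNP[z] : ~ ball y (n.+2%:R^-1 : R) `<=` G.
  by move=> yG; exact: nXGy.
rewrite ballEmdist/= => /not_implyP[yz nGz].
have xz : (n.+1%:R^-1 <= mdist x z)%R.
  by rewrite leNgt; apply/negP => xz; apply/nGz/xG; rewrite ballEmdist.
by rewrite lerBlDr (le_trans xz)// (le_trans (metric_triangle _ y _))// lerD2l ltW.
Qed.

Let sum_D p N : \sum_(0 <= k < N) mu (D (k.*2 + p)%N) <= mu X.
Proof.
suff: \sum_(0 <= k < N) mu (D (k.*2 + p)%N) <=
    mu (\big[setU/set0]_(0 <= k < N) D (k.*2 + p)%N).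
  move=> /le_trans; apply; apply: le_outer_measure.
  by rewrite -bigcup_seq => x [k _ [[[Xx _] _] _]].
elim: N => [|N ih]; first by rewrite !big_geq ?outer_measure_ge0.
rewrite !big_nat_recr//= (le_trans (leeD2r _ ih))// mu_separated//.
have [e e0 eXG] := separated_XG (N.*2 + p).-1.
exists e => // x y; rewrite -bigcup_seq => -[k/=]; rewrite mem_index_iota => /andP[_ kN].
move=> [XGx _] [XGy nXGy]; apply: eXG.
  by apply: le_XG XGx; rewrite -!addnn; lia.
by split; [exact: XGy.1|rewrite prednK// -addnn; lia].
Qed.

Let nneseries_D : \sum_(0 <= k <oo) mu (D k) < +oo.
Proof.
have : mu X + mu X < +oo by rewrite lte_add_pinfty.
apply: le_lt_trans; apply: lime_le.
  by apply: is_cvg_nneseries => k _ _; exact: outer_measure_ge0.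
apply: nearW => n.
apply: (@le_trans _ _ (\sum_(0 <= k < n.*2) mu (D k))).
  rewrite [leRHS](@big_cat_nat _ _ _ n 0 n.*2)//=; last by rewrite -addnn leq_addr.
  by rewrite leeDl// sume_ge0// => k _; exact: outer_measure_ge0.
have -> : \sum_(0 <= k < n.*2) mu (D k) =
    \sum_(0 <= k < n) mu (D (k.*2 + 0)%N) + \sum_(0 <= k < n) mu (D (k.*2 + 1)%N).
  elim: n => [|n ih]; first by rewrite !big_geq ?adde0.
  by rewrite doubleS !big_nat_recr//= ih addn0 addn1 -addeA addeACA.
by rewrite leeD// sum_D.
Qed.

Let XG_tail N : X `&` G `<=` XG N `|` \bigcup_(k in ~` `I_N) D k.
Proof.
rewrite bigcup_XG => x [n _]; elim: n => [|n ih] XGx.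
  by left; exact: le_XG XGx.
have [/ih//|nXGx] := pselect (XG n x).
have [nN|Nn] := ltnP n N; first by left; exact: le_XG XGx.
by right; exists n => //=; apply/negP; rewrite -leqNgt.
Qed.

Lemma metric_outer_measure_open : mu (X `&` G) + mu (X `&` ~` G) <= mu X.
Proof.
have h N : mu (X `&` G) + mu (X `&` ~` G) <= mu X + \sum_(N <= k <oo) mu (D k).
  have le1 : mu (X `&` G) <= mu (XG N) + \sum_(N <= k <oo) mu (D k).
    rewrite (le_trans (le_outer_measure mu _ _ (@XG_tail N)))//.
    rewrite (le_trans (outer_measureU2 _ _ _))// leeD2l//.
    exact: outer_measure_sigma_subadditive_tail.
  rewrite (le_trans (leeD2r _ le1))// addeAC leeD2r//.
  rewrite (le_trans (mu_separated (separated_XG_C N)))//.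
  by apply: le_outer_measure => x [[[]]|[]].
have cvgt : mu X + \sum_(N <= k <oo) mu (D k) @[N --> \oo] --> mu X + 0.
  apply: cvgeD; [by rewrite fin_num_adde_defl|exact: cvg_cst|].
  by apply: nneseries_tail_cvg => // k _; exact: outer_measure_ge0.
rewrite -[leRHS]adde0; apply: cvge_ge cvgt.
by apply: nearW.
Qed.

End metric_outer_measure.

Section hausdorff_borel.
Local Open Scope ereal_scope.
Context {R : realType} {T : pmetricType R}.
Implicit Types (a delta e : R) (A B X : set T).

Lemma le_hausdorff_delta_delta a delta delta' A : (delta <= delta')%R ->
  hausdorff_delta a delta' A <= hausdorff_delta a delta A.
Proof.
move=> dd; apply: ereal_inf_le_tmp => _ [U [dU AU] <-].
by exists U => //; split => // k; rewrite (le_trans (dU k))// lee_fin.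
Qed.

Let hausdorff_delta_separated a delta e A B : (delta < e)%R ->
  (forall x y, A x -> B y -> (e <= mdist x y)%R) ->
  hausdorff_delta a delta A + hausdorff_delta a delta B <=
  hausdorff_delta a delta (A `|` B).
Proof.
move=> de AB; apply: le_ereal_inf_tmp => _ [U [dU ABU] <-].
pose UC (C : set T) k := if `[< U k `&` C !=set0 >] then U k else set0.
have UCP C : C `<=` A `|` B -> delta_cover delta C (UC C).
  move=> CAB; split => [k|x Cx].
    by rewrite /UC; case: asboolP; rewrite // diam0 leNye.
  have [k _ Ukx] := ABU _ (CAB _ Cx).
  by exists k => //; rewrite /UC; case: asboolP => // -[]; exists x.
apply: (@le_trans _ _
    (\sum_(k <oo) diam_pow a (UC A k) + \sum_(k <oo) diam_pow a (UC B k))).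
  apply: leeD; apply: ereal_inf_lbound.
    by exists (UC A) => //; apply: UCP => x; left.
  by exists (UC B) => //; apply: UCP => x; right.
rewrite -nneseriesD//; try by move=> *; exact: diam_pow_ge0.
apply: lee_nneseries => [k _ _|k _]; first by rewrite adde_ge0// diam_pow_ge0.
rewrite /UC; case: asboolP => [[x [Ux Ax]]|_]; case: asboolP => [[y [Uy By]]|_];
  rewrite ?diam_pow0 ?adde0 ?add0e ?diam_pow_ge0//.
have := le_trans (le_mdist_diam Ux Uy) (dU k).
by rewrite lee_fin leNgt (lt_le_trans de)// AB.
Qed.

Lemma hausdorff_measure_separated a A B : metric_separated A B ->
  hausdorff_measure a A + hausdorff_measure a B <= hausdorff_measure a (A `|` B).
Proof.
move=> [e e0 AB].
have [ABoo|ABoo] := eqVneq (hausdorff_measure a (A `|` B)) +oo.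
  by rewrite ABoo leey.
have ABfin : hausdorff_measure a (A `|` B) \is a fin_num.
  by rewrite ge0_fin_numE ?lt_neqAle ?ABoo ?leey// outer_measure_ge0.
have fin C : C `<=` A `|` B -> hausdorff_measure a C \is a fin_num.
  move=> CAB; rewrite ge0_fin_numE ?outer_measure_ge0//.
  rewrite (le_lt_trans (le_outer_measure (hausdorff_measure a) _ _ CAB))//.
  by rewrite lt_neqAle ABoo leey.
have Bfin := fin _ (@subsetUr _ A B).
rewrite -leeBrDr//; apply: ge_ereal_sup => _ [d1 d10 <-].
have d1fin : hausdorff_delta a d1 A \is a fin_num.
  rewrite ge0_fin_numE ?hausdorff_delta_ge0//.
  rewrite (le_lt_trans (le_hausdorff_measure_delta _ _ d10))//.
  by rewrite -ge0_fin_numE ?outer_measure_ge0// fin//; exact: subsetUl.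
rewrite leeBrDr// -leeBrDl//; apply: ge_ereal_sup => _ [d2 d20 <-].
rewrite leeBrDl//; pose d := Num.min (e / 2)%R (Num.min d1 d2).
have d0 : (0 < d)%R by rewrite !lt_min d10 d20 !andbT divr_gt0.
apply: (@le_trans _ _ (hausdorff_delta a d (A `|` B))); last first.
  exact: le_hausdorff_measure_delta.
apply: le_trans (hausdorff_delta_separated _ _ AB).
  by apply: leeD; apply: le_hausdorff_delta_delta; rewrite !ge_min lexx ?orbT.
by rewrite gt_min; apply/orP; left; rewrite ltr_pdivrMr// ltr_pMr// ltr1n.
Qed.

Lemma borel_caratheodory a (A : set (borel T)) :
  measurable A -> (hausdorff_measure a).-caratheodory A.
Proof.
pose mu := hausdorff_measure a : {outer_measure set (borel T) -> \bar R}.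
apply: (@smallest_sub _ _ _ mu.-caratheodory).
  split => [|B mB|F mF].
  - exact: caratheodory_measurable_set0.
  - by rewrite setTD; exact: caratheodory_measurable_setC.
  - exact: caratheodory_measurable_bigcup.
move=> G oG; apply: le_caratheodory_measurable => X.
have [->|Xoo] := eqVneq (mu X) +oo; first by rewrite leey.
apply: (metric_outer_measure_open _ _ oG).
  exact: hausdorff_measure_separated.
by rewrite lt_neqAle Xoo leey.
Qed.

Let hausdorff_measure_semi_sigma_additive a :
  semi_sigma_additive (hausdorff_measure a : set (borel T) -> \bar R).
Proof.
pose mu := hausdorff_measure a : {outer_measure set (borel T) -> \bar R}.
move=> F mF tF mUF.
apply: (@caratheodory_measure_sigma_additive R (borel T) mu F) => //.
  by move=> i; exact: borel_caratheodory.
exact: borel_caratheodory.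
Qed.

HB.instance Definition _ a := isMeasure.Build _ (borel T) R
  (hausdorff_measure a)
  (outer_measure0 (hausdorff_measure a)) (outer_measure_ge0 (hausdorff_measure a))
  (@hausdorff_measure_semi_sigma_additive a).

End hausdorff_borel.

Definition bi_lipschitz (R : realType) (X Y : metricType R)
    (A : set X) (B : set Y) (f : X -> Y) : Prop :=
  set_bij A B f /\
  exists2 C : R, 0 < C & forall x y, A x -> A y ->
    C^-1 * mdist x y <= mdist (f x) (f y) <= C * mdist x y.

Definition alpha_set (R : realType) (n : nat) (alpha : R)
    (F : set (euclidean R n)) : Prop :=
  closed F /\
  exists (nu : {measure set (borel (euclidean R n)) -> \bar R}) (C : R),
    0 < C /\ forall (x : euclidean R n) (r : R), F x -> 0 < r < 1 ->
      ((C^-1 * r `^ alpha)%:E <= nu (F `&` ball x r) <= (C * r `^ alpha)%:E)%E.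

(* The space is a subset M of an ambient metric space T, with the metric and
   the measure of T restricted to M: the balls of M are the M `&` ball x r. *)
Section critical_exponent.
Local Open Scope ereal_scope.
Context {R : realType} {T : pmetricType R}.
Variables (M : set T) (mu : {measure set (borel T) -> \bar R}).
Implicit Types (sigma : R) (u : T -> R).

Definition besov_energy sigma u : \bar R :=
  ereal_sup [set (r `^ (- (2 * sigma)))%:E *
    \int[mu]_(x in M) ((mu (M `&` ball (x : T) r))^-1 *
      \int[mu]_(y in M `&` ball (x : T) r) (`|u x - u y| ^+ 2)%:E)
    | r in [set r : R | (0 < r < 1)%R]].

Definition besov sigma u : Prop :=
  [/\ measurable_fun (M : set (borel T)) u,
      \int[mu]_(x in M) (`|u x| ^+ 2)%:E < +oo &
      besov_energy sigma u < +oo].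

Definition nonconstant u : Prop :=
  ~ exists c : R, {ae mu, forall x, M x -> u x = c}.

Definition critical_exponent : \bar R :=
  2%:E * ereal_sup [set sigma%:E | sigma in
    [set sigma : R | (0 < sigma)%R /\ exists u, besov sigma u /\ nonconstant u]].

End critical_exponent.

(* Main.v *)
Require Import Defs.
From HB Require Import structures.
From mathcomp Require Import all_boot all_order all_algebra.
From mathcomp Require Import all_classical all_reals all_analysis.
From mathcomp Require Import measurable_realfun ring lra.

Set Implicit Arguments.
Unset Strict Implicit.
Unset Printing Implicit Defensive.

Import Order.TTheory GRing.Theory Num.Theory.
Import numFieldNormedType.Exports.

Local Open Scope classical_set_scope.
Local Open Scope ring_scope.

(** A Besov function on one of the two sets is turned into a Besov function of the
    same order on the other one by composition with the bi-Lipschitz map between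
    them; since the situation is symmetric, the sets of admissible orders
    coincide, and so do the critical exponents.

    Let [H] be the [alpha]-dimensional Hausdorff measure. The map and its inverse
    multiply [H] by at most [L `^ alpha] ([hausdorff_measure_lipschitz]), and
    they are Borel because Lipschitz functions are ([lipschitz_measurable]) and
    because the image of a closed set is closed ([bilipschitz_closed]). So
    integrals over the two sets are comparable ([ge0_integral_le_image]), and
    null sets correspond to each other ([nonconstant_comp_inverse]).

    The Besov energy also involves volumes of balls. An [alpha]-set is only
    assumed to carry some Ahlfors regular measure; the mass distribution
    principle ([mass_distribution]) and a packing argument ([hausdorff_upper])
    show that [H] is then regular too ([ahlfors_hausdorff]), first at the scales
    below 1 and then, by covering a ball of the Euclidean space by a bounded
    number of small balls, at all bounded scales ([ahlfors_all_scales]).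
    Regularity at all bounded scales passes to the image
    ([ahlfors_lipschitz_image]).

    Dividing by the volume of a ball of radius [r] thus amounts to multiplying by
    [r `^ (- alpha)], and the energy of the transported function at scale [r] is
    at most a constant times the energy of the original one at scale [L * r]
    ([average_comp_inverse]). If [L * r < 1] the latter is part of the Besov
    seminorm ([near_energy_le_average]). Otherwise [r] is bounded away from 0 and
    the energy is bounded by the square of the L2 norm, by Tonelli's theorem and
    the bound on volumes of balls of radius [L * r] ([near_energy_le_L2]). *)

(** * Lipschitz maps, Hausdorff measure and Borel sets *)

Definition lipschitz_within (R : realType) (X Y : metricType R) (L : R)
    (A : set X) (f : X -> Y) : Prop :=
  forall x y, A x -> A y -> mdist (f x) (f y) <= L * mdist x y.

Lemma lipschitz_withinS (R : realType) (X Y : metricType R) (L : R)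
    (A B : set X) (f : X -> Y) :
  A `<=` B -> lipschitz_within L B f -> lipschitz_within L A f.
Proof. by move=> AB Lf x y /AB Bx /AB By; exact: Lf. Qed.

Section hausdorff_lipschitz.
Local Open Scope ereal_scope.
Context {R : realType} {X Y : pmetricType R}.
Variables (L a : R) (A : set X) (f : X -> Y).
Hypotheses (L0 : (0 < L)%R) (a0 : (0 <= a)%R).
Hypothesis (Lf : lipschitz_within L A f).

Lemma diam_ge0 (Z : pmetricType R) (U : set Z) : U !=set0 -> 0 <= diam U.
Proof.
by move=> [x Ux]; apply: le_trans (le_mdist_diam Ux Ux); rewrite lee_fin mdist_ge0.
Qed.

Lemma diam_lipschitz (U : set X) : diam (f @` (U `&` A)) <= L%:E * diam U.
Proof.
apply: ge_ereal_sup => _ [_ [x [Ux Ax] <-] [_ [y [Uy Ay] <-] <-]].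
apply: (@le_trans _ _ (L%:E * (mdist x y)%:E)).
  by rewrite -EFinM lee_fin Lf.
by rewrite lee_pmul2l// le_mdist_diam.
Qed.

Lemma diam_pow_lipschitz (U : set X) :
  diam_pow a (f @` (U `&` A)) <= (L `^ a)%:E * diam_pow a U.
Proof.
rewrite {1}/diam_pow; case: ifPn => [_|/set0P nV].
  by rewrite mule_ge0 ?diam_pow_ge0// lee_fin powR_ge0.
have nU : U !=set0 by case: nV => _ [x [Ux _] _]; exists x.
rewrite /diam_pow ifF; last by apply/negbTE/set0P.
rewrite -poweR_EFin -poweRM ?lee_fin ?(ltW L0) ?diam_ge0//.
apply: gt0_ler_poweR => //.
- by rewrite in_itv/= leey andbT diam_ge0.
- by rewrite in_itv/= leey andbT mule_ge0 ?diam_ge0// lee_fin ltW.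
- exact: diam_lipschitz.
Qed.

(** The images of the pieces of a [delta / L]-cover of [A] form a [delta]-cover
    of its image, and each of them costs at most [L `^ a] times as much. *)
Lemma hausdorff_measure_lipschitz :
  hausdorff_measure a (f @` A) <= (L `^ a)%:E * hausdorff_measure a A.
Proof.
apply: ge_ereal_sup => _ [delta d0 <-].
have La0 : (0 < L `^ a)%R by exact: powR_gt0.
apply: (@le_trans _ _ ((L `^ a)%:E * hausdorff_delta a (delta / L)%R A)); last first.
  by rewrite lee_pmul2l// le_hausdorff_measure_delta// divr_gt0.
rewrite -lee_pdivrMl//; apply: le_ereal_inf_tmp => _ [U [dU AU] <-].
rewrite lee_pdivrMl//.
rewrite -nneseriesZl; last by move=> i _; exact: diam_pow_ge0.
apply: (@le_trans _ _ (\sum_(k <oo) diam_pow a (f @` (U k `&` A)))).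
  apply: ereal_inf_lbound; exists (fun k => f @` (U k `&` A)) => //; split.
    move=> k; apply: (le_trans (diam_lipschitz _)).
    rewrite -lee_pdivlMl// -EFinM mulrC; exact: dU.
  by move=> _ [x Ax <-]; have [k _ Ukx] := AU _ Ax; exists k => //; exists x.
apply: lee_nneseries => [k _ _|k _]; first exact: diam_pow_ge0.
exact: diam_pow_lipschitz.
Qed.

End hausdorff_lipschitz.

(** Only the values of [f] on [A] are controlled: the preimage of an open set is
    the trace on [A] of the interior of the set of the points which, if in [A],
    are mapped into that open set. *)
Lemma lipschitz_measurable (R : realType) (X Y : pmetricType R) (L : R)
    (A : set X) (f : X -> Y) : 0 < L -> lipschitz_within L A f ->
  measurable (A : set (borel X)) ->
  measurable_fun (A : set (borel X)) (f : borel X -> borel Y).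
Proof.
move=> L0 Lf mA; apply: (measurability (@open Y : set (set (borel Y)))) => // _ [V oV <-].
pose W : set X := interior [set x | A x -> V (f x)].
rewrite (_ : _ `&` _ = A `&` W); last first.
  apply/seteqP; split => x [Ax]/=; last by move=> /interior_subset /(_ Ax).
  move=> Vfx; split => //; have /nbhs_ballP[e/= e0 eV] : nbhs (f x) V by exact: open_nbhs_nbhs.
  apply/nbhs_ballP; exists (e / L) => /=; first by rewrite divr_gt0.
  move=> y; rewrite ballEmdist/= => xy Ay; apply: eV; rewrite ballEmdist/=.
  by rewrite (le_lt_trans (Lf _ _ Ax Ay))// mulrC -ltr_pdivlMr.
apply: measurableI => //; apply: sub_sigma_algebra.
exact: open_interior.
Qed.

(** A bi-Lipschitz bijection together with its inverse, both Lipschitz with the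
    same constant: this form is symmetric in the two sets, so that each
    comparison below has to be proved in one direction only. *)
Definition bilipschitz_inverses (R : realType) (X Y : metricType R) (L : R)
    (A : set X) (B : set Y) (f : X -> Y) (g : Y -> X) : Prop :=
  [/\ forall x, A x -> B (f x) /\ g (f x) = x,
      forall y, B y -> A (g y) /\ f (g y) = y,
      lipschitz_within L A f & lipschitz_within L B g].

Lemma bilipschitz_inverses_sym (R : realType) (X Y : metricType R) (L : R)
    (A : set X) (B : set Y) (f : X -> Y) (g : Y -> X) :
  bilipschitz_inverses L A B f g -> bilipschitz_inverses L B A g f.
Proof. by case. Qed.

Lemma bi_lipschitz_inverse (R : realType) (X Y : pmetricType R)
    (A : set X) (B : set Y) (f : X -> Y) : bi_lipschitz A B f ->
  exists (L : R) (g : Y -> X), 1 <= L /\ bilipschitz_inverses L A B f g.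
Proof.
move=> [[fAB finj fsurj] [C C0 fC]].
have /choice[g gP] : forall y, exists x, B y -> A x /\ f x = y.
  move=> y; have [/fsurj[x Ax fxy]|nBy] := pselect (B y); first by exists x.
  by exists point => /nBy.
have gK x : A x -> g (f x) = x.
  move=> Ax; have [Agfx] := gP _ (fAB _ Ax).
  by apply: finj; rewrite inE.
(* C may be less than 1 if A has at most one point. *)
exists (Num.max C 1), g; split; first by rewrite le_max lexx orbT.
split.
- by move=> x Ax; split; [exact: fAB|exact: gK].
- by move=> y /gP.
- move=> x y Ax Ay; have /andP[_] := fC _ _ Ax Ay.
  move=> /le_trans; apply; rewrite ler_wpM2r ?mdist_ge0// le_max lexx//.
- move=> y z /gP[Agy fgy] /gP[Agz fgz]; rewrite -{2}fgy -{2}fgz.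
  have /andP[+ _] := fC _ _ Agy Agz; rewrite ler_pdivrMl// => /le_trans; apply.
  by rewrite ler_wpM2r ?mdist_ge0// le_max lexx.
Qed.

(** A set is the image of its preimage, and the preimage is the image under the
    inverse: hence Hausdorff measures are comparable in both directions. *)
Lemma hausdorff_measure_preimage_le (R : realType) (X Y : pmetricType R)
    (a L : R) (A : set X) (B S : set Y) (f : X -> Y) (g : Y -> X) :
  0 < L -> 0 <= a -> bilipschitz_inverses L A B f g -> S `<=` B ->
  (hausdorff_measure a S <=
    (L `^ a)%:E * hausdorff_measure a (A `&` f @^-1` S))%E.
Proof.
move=> L0 a0 [_ gP Lf _] SB.
apply: le_trans (hausdorff_measure_lipschitz L0 a0 (lipschitz_withinS _ Lf));
  last exact: subIsetl.
apply: le_outer_measure => y Sy; have [Ay fy] := gP _ (SB _ Sy).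
by exists (g y) => //; split=> //; rewrite /preimage/= fy.
Qed.

(** * Completeness of Euclidean space and closed images *)

Section euclidean_coordinates.
Context {R : realType} {n : nat}.
Implicit Types x y : euclidean R n.

Lemma coord_le_mdist x y (i : 'I_n) : `|x ord0 i - y ord0 i| <= mdist x y.
Proof.
rewrite -sqrtr_sqr; apply: ler_wsqrtr.
by rewrite (bigD1 i)//= lerDl sumr_ge0// => j _; rewrite sqr_ge0.
Qed.

Lemma mdist_le_sum x y : mdist x y <= \sum_(i < n) `|x ord0 i - y ord0 i|.
Proof.
have S0 : 0 <= \sum_(i < n) `|x ord0 i - y ord0 i| by exact: sumr_ge0.
rewrite -(@ler_pXn2r _ 2%N)// ?nnegrE ?mdist_ge0// sqr_sqrtr; last first.
  by apply: sumr_ge0 => i _; rewrite sqr_ge0.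
rewrite [leRHS]expr2 mulr_suml; apply: ler_sum => i _.
rewrite -real_normK ?num_real// expr2 ler_wpM2l//.
by rewrite (bigD1 i)//= lerDl sumr_ge0.
Qed.

Lemma mdist_lt_coord (e : R) x y : 0 < e ->
  (forall i, `|x ord0 i - y ord0 i| <= e / n.+1%:R) -> mdist x y < e.
Proof.
move=> e0 xy; rewrite (le_lt_trans (mdist_le_sum _ _))//.
apply: (@le_lt_trans _ _ (\sum_(i < n) e / n.+1%:R)); first exact: ler_sum.
rewrite sumr_const card_ord -mulrnAr -[ltRHS]mulr1 ltr_pM2l//.
by rewrite -[_ *+ n]mulr_natl ltr_pdivrMr// mul1r ltr_nat.
Qed.

(** A Cauchy filter converges coordinatewise because the coordinates are
    1-Lipschitz, and convergence of the finitely many coordinates is convergence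
    in the Euclidean metric. *)
Lemma euclidean_cauchy_cvg (G : set_system (euclidean R n)) : ProperFilter G ->
  (forall e : R, 0 < e -> exists x, G (ball x e)) ->
  exists l : euclidean R n, forall e : R, 0 < e -> G (ball l e).
Proof.
move=> PG cG.
have /choice[l lP] (i : 'I_n) : exists l : R,
    (fun x : euclidean R n => x ord0 i) @ G --> l.
  apply/cvg_ex/cauchy_cvgP/cauchy_exP => e e0.
  have [x xG] := cG _ e0; exists (x ord0 i).
  suff: G [set y | ball (x ord0 i) e (y ord0 i)] by [].
  apply: filterS xG => y; rewrite ballEmdist/= => xy.
  exact: le_lt_trans (coord_le_mdist x y i) xy.
exists (\row_i l i) => e e0.
have : G [set x | forall i, `|l i - x ord0 i| <= e / n.+1%:R].
  apply: filter_forall => i; have /cvgrPdist_le := lP i.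
  by apply; rewrite divr_gt0.
apply: filterS => x xl; rewrite ballEmdist/=; apply: mdist_lt_coord => // i.
by rewrite mxE.
Qed.

End euclidean_coordinates.

(** The inverse maps a filter of points of [B] converging to a limit point of [B]
    to a Cauchy filter on [A]; its limit is in [A], and its image is the given
    limit point. *)
Lemma bilipschitz_closed (R : realType) (n : nat) (Y : pmetricType R) (L : R)
    (A : set (euclidean R n)) (B : set Y) f g : 0 < L ->
  bilipschitz_inverses L A B f g -> closed A -> closed B.
Proof.
move=> L0 [fP gP Lf Lg] cA y yB.
pose G := g z @[z --> within B (nbhs y)].
have PW : ProperFilter (within B (nbhs y)).
  by apply: within_nbhs_proper.
have nearB (e : R) : 0 < e -> within B (nbhs y) (ball y e `&` B).
  move=> e0; rewrite /within/=; apply: filterS (nbhsx_ballx y e e0) => z; split=> //.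
have [] := @euclidean_cauchy_cvg R n G _.
  move=> e e0; have eL : 0 < e / L / 2 by rewrite !divr_gt0.
  have [z [Bz yz]] := yB _ (nbhsx_ballx y _ eL).
  exists (g z); apply: filterS (nearB _ eL) => w [yw Bw].
  rewrite /= ballEmdist/= (le_lt_trans (Lg _ _ Bz Bw))// mulrC -ltr_pdivlMr//.
  move: yz yw; rewrite !ballEmdist/= => yz yw.
  rewrite (le_lt_trans (metric_triangle _ y _))// [ltRHS]splitr ltrD//.
  by rewrite metric_sym.
move=> l Gl.
have Al : A l.
  apply: cA => U /nbhs_ballP[e/= e0 eU].
  have [z [[yz Bz] lgz]] := filter_ex (filterI (nearB _ ltr01) (Gl _ e0)).
  by exists (g z); split; [case: (gP _ Bz)|exact: eU].
suff -> : y = f l by case: (fP _ Al).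
apply: mdist_positivity; apply/eqP; rewrite eq_le mdist_ge0 andbT.
apply/ler_addgt0Pl => e e0; rewrite addr0.
have e2 : 0 < e / 2 by rewrite divr_gt0.
have eL : 0 < e / 2 / L by rewrite divr_gt0.
have [z [[yz Bz] lgz]] := filter_ex (filterI (nearB _ e2) (Gl _ eL)).
have [Agz fgz] := gP _ Bz.
move: yz lgz; rewrite /= !ballEmdist/= => yz lgz.
rewrite (le_trans (metric_triangle _ z _))// [leRHS]splitr lerD ?(ltW yz)//.
rewrite -fgz metric_sym (le_trans (Lf _ _ Al Agz))// mulrC -ler_pdivlMr//.
exact: ltW.
Qed.

(** * Separated sequences and packing *)

Section packing.
Context {R : realType} {T : pmetricType R}.

Definition separated_seq (delta : R) (s : seq T) : bool :=
  pairwise (fun x y => delta <= mdist x y) s.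

(** A separated sequence of maximal length is a net, since a point far from all
    its terms could be added to it. *)
Lemma separated_net (A : set T) (delta : R) (N : nat) :
  (forall s, (forall x, x \in s -> A x) -> separated_seq delta s ->
    (size s <= N)%N) ->
  exists s, [/\ forall x, x \in s -> A x, separated_seq delta s &
    A `<=` \bigcup_(x in [set` s]) ball x delta].
Proof.
move=> sN; apply: contrapT => nnet.
suff [s [sA ss]] : exists s, [/\ forall x, x \in s -> A x,
    separated_seq delta s & size s = N.+1].
  by move=> sz; have := sN s sA ss; rewrite sz ltnn.
elim: N.+1 => [|k [s [sA ss sk]]]; first by exists [::].
have /existsNP[y /not_implyP[Ay ny]] :
    ~ A `<=` \bigcup_(x in [set` s]) ball x delta.
  by move=> As; apply: nnet; exists s.
exists (y :: s); split.
- by move=> x; rewrite inE => /orP[/eqP ->//|/sA].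
- rewrite /separated_seq/= -/(separated_seq delta s) ss andbT.
  apply/allP => x xs; rewrite leNgt; apply/negP => yx; apply: ny.
  by exists x => //; rewrite ballEmdist/= metric_sym.
- by rewrite /= sk.
Qed.

Local Open Scope ereal_scope.

Lemma borel_measurable_ball (x : T) (r : R) : measurable (ball x r : set (borel T)).
Proof.
apply: sub_sigma_algebra; rewrite /open/=.
have -> : ball x r = interior (ball x r).
  apply/seteqP; split; last exact: interior_subset.
  move=> y; rewrite ballEmdist/= => xy; apply/nbhs_ballP.
  exists (r - mdist x y)%R; rewrite /= ?subr_gt0// => z.
  rewrite !ballEmdist/= => yz.
  by rewrite (le_lt_trans (metric_triangle _ y _))// -ltrBrDl.
exact: open_interior.
Qed.

Lemma borel_measurable_closed (A : set T) :
  closed A -> measurable (A : set (borel T)).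
Proof.
move=> cA; rewrite -(setCK A); apply: measurableC; apply: sub_sigma_algebra.
exact: closed_openC.
Qed.

Lemma measurable_bigcup_ball (s : seq T) (r : R) :
  measurable (\bigcup_(x in [set` s]) ball x r : set (borel T)).
Proof.
rewrite bigcup_seq; apply: bigsetU_measurable => x _.
exact: borel_measurable_ball.
Qed.

Lemma bigcup_ball_cons (x : T) (s : seq T) (r : R) :
  \bigcup_(z in [set` x :: s]) ball z r =
  ball x r `|` \bigcup_(z in [set` s]) ball z r.
Proof.
apply/seteqP; split => y/=.
  move=> [z/=]; rewrite inE => /orP[/eqP ->|zs] zy; first by left.
  by right; exists z.
by move=> [xy|[z zs zy]]; [exists x|exists z]; rewrite //= inE ?eqxx ?zs ?orbT.
Qed.

(** Balls of half the separation are disjoint, so the measure of their union is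
    the sum of their measures. *)
Lemma separated_measure_sum (F : set T) (nu : {measure set (borel T) -> \bar R})
    (delta : R) (c : R) (s : seq T) : measurable (F : set (borel T)) ->
  (forall x, x \in s -> c%:E <= nu (F `&` ball x (delta / 2)%R)) ->
  separated_seq delta s ->
  ((size s)%:R * c)%:E <=
    nu (F `&` \bigcup_(x in [set` s]) ball x (delta / 2)%R).
Proof.
move=> mF; elim: s => [|x s ih] cs; first by rewrite mul0r measure_ge0.
rewrite /separated_seq/= => /andP[xs ss].
have mb := measurable_bigcup_ball s (delta / 2)%R.
rewrite bigcup_ball_cons setIUr measureU//=; last 3 first.
- by apply: measurableI => //; exact: borel_measurable_ball.
- exact: measurableI.
- rewrite -subset0 => y [[_ xy] [_ [z zs zy]]].
  have /allP/(_ _ zs) := xs; rewrite leNgt => /negP; apply.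
  move: xy zy; rewrite !ballEmdist/= => xy zy.
  rewrite (le_lt_trans (metric_triangle _ y _))// [ltRHS]splitr ltrD//.
  by rewrite metric_sym.
rewrite -natr1 mulrDl mul1r addrC EFinD leeD//.
  by apply: cs; rewrite inE eqxx.
by apply: ih => // z zs; apply: cs; rewrite inE zs orbT.
Qed.

Lemma diam_ball (x : T) (r : R) : diam (ball x r) <= (2 * r)%:E.
Proof.
apply: ge_ereal_sup => _ [y xy [z xz <-]]; move: xy xz; rewrite !ballEmdist/= => xy xz.
rewrite lee_fin (le_trans (metric_triangle _ x _))// mulrDl mul1r lerD// ltW//.
by rewrite metric_sym.
Qed.

Lemma hausdorff_delta_net (a delta : R) (A : set T) (s : seq T) :
  (0 <= a)%R -> (0 < delta)%R ->
  A `<=` \bigcup_(x in [set` s]) ball x delta ->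
  hausdorff_delta a (2 * delta)%R A <= ((size s)%:R * (2 * delta) `^ a)%:E.
Proof.
move=> a0 d0 As; pose U k := nth set0 [seq ball x delta | x <- s] k.
apply: (@le_trans _ _ (\sum_(k <oo) diam_pow a (U k))).
  apply: ereal_inf_lbound; exists U => //; split => [k|x /As[y/= ys yx]].
    rewrite /U; have [ks|sk] := ltnP k (size s).
      by rewrite (nth_map point)// diam_ball.
    by rewrite nth_default ?size_map// diam0 leNye.
  exists (index y s) => //; rewrite /U (nth_map point) ?index_mem//.
  by rewrite nth_index.
rewrite /U => {U As}; elim: s => [|x s ih] /=.
  by rewrite eseries0 ?mul0r// => k _ _; rewrite nth_nil diam_pow0.
rewrite nneseries_recl//; last by move=> k _; exact: diam_pow_ge0.
rewrite -nneseries_addn; last by move=> k; exact: diam_pow_ge0.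
rewrite -natr1 mulrDl mul1r [X in X%:E]addrC EFinD leeD//=; last first.
  by under eq_eseriesr do rewrite addn1/=.
rewrite /diam_pow; case: ifPn => [_|/set0P nb]; first by rewrite lee_fin powR_ge0.
rewrite -poweR_EFin; apply: gt0_ler_poweR => //; rewrite ?in_itv/= ?leey ?andbT.
- exact: diam_ge0.
- by rewrite lee_fin mulr_ge0// ltW.
- exact: diam_ball.
Qed.

End packing.

(** * Hausdorff measure of an Ahlfors regular set *)

Section mass_distribution.
Local Open Scope ereal_scope.
Context {R : realType} {T : pmetricType R}.
Variables (a C : R) (F : set T) (nu : {measure set (borel T) -> \bar R}).
Hypotheses (a0 : (0 < a)%R) (C0 : (0 < C)%R) (mF : measurable (F : set (borel T))).
Hypothesis nuF : forall (x : T) (r : R), F x -> (0 < r < 1)%R ->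
  nu (F `&` ball x r) <= (C * r `^ a)%:E.

(* A set of diameter 0 has Hausdorff cost 0, so points must be negligible. *)
Let nu_singleton (x : T) : F x -> exists W : set T, [/\ measurable (W : set (borel T)),
  W x & nu W = 0].
Proof.
move=> Fx; pose W := F `&` \bigcap_k ball x (k.+1%:R^-1 : R).
have mW : measurable (W : set (borel T)).
  by apply: measurableI => //; apply: bigcap_measurable => // k _; exact: borel_measurable_ball.
exists W; split => //.
  by split=> // k _; rewrite ballEmdist/= mdistxx.
apply/eqP; rewrite eq_le measure_ge0 andbT.
apply/lee_addgt0Pr => e e0; rewrite add0e.
(* The bound C * r `^ a on the measure of a ball of this radius is at most e. *)
pose r : R := Num.min 2^-1%R ((e / C) `^ a^-1)%R.
have r0 : (0 < r)%R by rewrite lt_min invr_gt0 ltr0n/= powR_gt0// divr_gt0.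
have r1 : (r < 1)%R by rewrite gt_min invf_lt1// ltr1n.
have [k _ kr] := near_infty_natSinv_lt (PosNum r0).
apply: (@le_trans _ _ (nu (F `&` ball x r))).
  apply: le_measure; rewrite ?inE//; first by apply: measurableI => //; exact: borel_measurable_ball.
  move=> y [Fy /(_ k I) xy]; split=> //; apply: le_ball xy.
  by apply: ltW; apply: kr => /=.
rewrite (le_trans (nuF Fx _)) ?r0//.
rewrite lee_fin -ler_pdivlMl// mulrC.
have -> : (e / C = ((e / C) `^ a^-1) `^ a)%R.
  by rewrite -powRrM mulVf ?gt_eqF// powRr1// ltW// divr_gt0.
apply: ge0_ler_powR; rewrite ?nnegrE ?powR_ge0 ?(ltW a0) ?(ltW r0)//.
by rewrite ge_min lexx orbT.
Qed.

Let nu_piece (U : set T) : diam U <= (4^-1)%:E ->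
  exists W : set T, [/\ measurable (W : set (borel T)), U `&` F `<=` W &
    nu W <= (C * 2 `^ a)%:E * diam_pow a U].
Proof.
move=> dU; have [[x [Ux Fx]]|nUF] := pselect (U `&` F !=set0); last first.
  exists set0; split => //; first by move=> x UFx; apply: nUF; exists x.
  by rewrite measure0 mule_ge0 ?diam_pow_ge0// lee_fin mulr_ge0 ?powR_ge0// ltW.
have nU : U !=set0 by exists x.
have [d dE] : exists d : R, diam U = d%:E.
  exists (fine (diam U)); rewrite fineK// ge0_fin_numE ?diam_ge0//.
  by rewrite (le_lt_trans dU)// ltry.
have := diam_ge0 nU; rewrite dE lee_fin le_eqVlt => /orP[/eqP d0|d0].
  have [W [mW Wx W0]] := nu_singleton Fx.
  exists W; split => //; last first.
    by rewrite W0 mule_ge0 ?diam_pow_ge0// lee_fin mulr_ge0 ?powR_ge0// ltW.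
  move=> y [Uy _]; suff -> : y = x by [].
  apply/mdist_positivity/eqP; rewrite eq_le mdist_ge0 andbT -lee_fin d0 -dE.
  exact: le_mdist_diam.
have d4 : (d <= 4^-1)%R by rewrite -lee_fin -dE.
exists (F `&` ball x (2 * d)%R); split.
- by apply: measurableI => //; exact: borel_measurable_ball.
- move=> y [Uy Fy]; split => //; rewrite ballEmdist/=.
  have := le_mdist_diam Ux Uy; rewrite dE lee_fin => /le_lt_trans; apply.
  by rewrite ltr_pMl// ltr1n.
- rewrite /diam_pow ifF; last by apply/negbTE/set0P.
  rewrite dE poweR_EFin -EFinM -mulrA -powRM ?(ltW d0)//.
  by apply: nuF => //; rewrite mulr_gt0//=; lra.
Qed.

(** Mass distribution principle: a set of diameter [d] that meets [F] lies in a
    ball of radius [2 * d] centred in [F], whose [nu]-mass is at most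
    [C * (2 * d) `^ a]; sum over a cover of [A]. *)
Lemma mass_distribution (A : set T) : measurable (A : set (borel T)) -> A `<=` F ->
  nu A <= (C * 2 `^ a)%:E * hausdorff_measure a A.
Proof.
move=> mA AF; have K0 : (0 < C * 2 `^ a)%R by rewrite mulr_gt0 ?powR_gt0.
(* Any scale below 1/2 will do: the bound on nu is used for radii 2 * d < 1. *)
apply: (@le_trans _ _ ((C * 2 `^ a)%:E * hausdorff_delta a 4^-1 A)); last first.
  by rewrite lee_pmul2l// le_hausdorff_measure_delta// invr_gt0.
rewrite -lee_pdivrMl//; apply: le_ereal_inf_tmp => _ [U [dU AU] <-].
rewrite lee_pdivrMl// -nneseriesZl; last by move=> i _; exact: diam_pow_ge0.
have /choice[W WP] k := nu_piece (dU k).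
apply: (@le_trans _ _ (\sum_(k <oo) nu (W k))).
  apply: measure_sigma_subadditive => //; first by move=> k; case: (WP k).
  move=> x Ax; have [k _ Ukx] := AU _ Ax; exists k => //.
  by have [_ + _] := WP k; apply; split=> //; exact: AF.
by apply: lee_nneseries => [k _ _|k _]; [exact: measure_ge0|case: (WP k)].
Qed.

End mass_distribution.

(** Ahlfors regularity at the scales below [rho]; the definition of an
    [alpha_set] asks for it with [rho = 1]. *)
Definition ahlfors_upto (R : realType) (T : pmetricType R) (a rho K : R) (F : set T)
    (mu : set (borel T) -> \bar R) : Prop :=
  forall (x : T) (r : R), F x -> 0 < r < rho ->
    ((K^-1 * r `^ a)%:E <= mu (F `&` ball x r) <= (K * r `^ a)%:E)%E.

Section hausdorff_ahlfors.
Local Open Scope ereal_scope.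
Context {R : realType} {T : pmetricType R}.
Variables (a C : R) (F : set T) (nu : {measure set (borel T) -> \bar R}).
Hypotheses (a0 : (0 < a)%R) (C0 : (0 < C)%R) (mF : measurable (F : set (borel T))).
Hypothesis nuF : ahlfors_upto a 1 C F nu.

(* The packing bound: the disjoint half-balls around the points of a separated
   net all lie in the ball of radius r + delta / 2. *)
Let net (x : T) (r delta : R) : F x -> (0 < delta)%R ->
  (0 < r)%R -> (r + delta / 2 < 1)%R ->
  exists s : seq T, F `&` ball x r `<=` \bigcup_(y in [set` s]) ball y delta /\
    ((size s)%:R * (C^-1 * (delta / 2) `^ a) <= C * (r + delta / 2) `^ a)%R.
Proof.
move=> Fx d0 r0 rd1; have d2 : (0 < delta / 2)%R by rewrite divr_gt0.
have c0 : (0 < C^-1 * (delta / 2) `^ a)%R by rewrite mulr_gt0 ?powR_gt0// invr_gt0.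
have sepP (s : seq T) : (forall y, y \in s -> (F `&` ball x r) y) -> separated_seq delta s ->
    ((size s)%:R * (C^-1 * (delta / 2) `^ a) <= C * (r + delta / 2) `^ a)%R.
  move=> sF ss; rewrite -lee_fin.
  apply: (le_trans (@separated_measure_sum _ _ F nu delta _ s mF _ ss)).
    move=> y /sF[Fy _].
    suff /(nuF Fy)/andP[] : (0 < delta / 2 < 1)%R by [].
    by rewrite d2 (lt_trans _ rd1)// ltrDr.
  have : (0 < r + delta / 2 < 1)%R by rewrite addr_gt0.
  move=> /(nuF Fx)/andP[_]; apply: le_trans; apply: le_measure; rewrite ?inE//.
  - by apply: measurableI => //; exact: measurable_bigcup_ball.
  - by apply: measurableI => //; exact: borel_measurable_ball.
  - move=> z [Fz [y/= /sF[_ xy] yz]]; split=> //.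
    exact: ball_triangle xy yz.
pose N := Num.truncn (C * (r + delta / 2) `^ a / (C^-1 * (delta / 2) `^ a))%R.
have [s [sF ss Fs]] : exists s, [/\ forall y, y \in s -> (F `&` ball x r) y,
    separated_seq delta s & F `&` ball x r `<=` \bigcup_(y in [set` s]) ball y delta].
  apply: (@separated_net _ _ _ _ N) => s sF ss.
  by rewrite truncn_ge_nat ?divr_ge0 ?mulr_ge0 ?powR_ge0 ?invr_ge0 ?(ltW C0)// ler_pdivlMr// sepP.
by exists s; split=> //; exact: sepP.
Qed.

(** Cover the ball by the balls of a net of mesh [d]: their number is at most of
    order [(r / d) `^ a], and each costs of order [d `^ a]. *)
Lemma hausdorff_upper (x : T) (r : R) : F x -> (0 < r < 1)%R ->
  hausdorff_measure a (F `&` ball x r) <= (C ^+ 2 * 8 `^ a * r `^ a)%:E.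
Proof.
move=> Fx /andP[r0 r1]; apply: ge_ereal_sup => _ [e e0 <-].
(* Besides being fine enough, the mesh must keep the ball enlarged by d / 2 at
   radius less than 1, and comparable to r. *)
pose d : R := Num.min (e / 2)%R (Num.min r (1 - r)%R).
have d0 : (0 < d)%R by rewrite !lt_min r0 subr_gt0 r1 divr_gt0.
have [de [dr dr1]] : (2 * d <= e /\ d <= r /\ d <= 1 - r)%R.
  by rewrite mulrC -ler_pdivlMr// !ge_min !lexx !orbT.
have [s [Fs sN]] : exists s : seq T, F `&` ball x r `<=` \bigcup_(y in [set` s]) ball y d /\
    ((size s)%:R * (C^-1 * (d / 2) `^ a) <= C * (r + d / 2) `^ a)%R.
  by apply: net => //; lra.
apply: (le_trans (le_hausdorff_delta_delta _ _ de)).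
apply: (le_trans (hausdorff_delta_net (ltW a0) d0 Fs)); rewrite lee_fin.
have -> : (2 * d = 4 * (d / 2))%R by lra.
rewrite powRM ?divr_ge0 ?(ltW d0)// -(@ler_pM2l _ C^-1) ?invr_gt0//.
have -> : (C^-1 * ((size s)%:R * (4 `^ a * (d / 2) `^ a)) =
  4 `^ a * ((size s)%:R * (C^-1 * (d / 2) `^ a)))%R by ring.
apply: (@le_trans _ _ (4 `^ a * (C * (r + d / 2) `^ a))%R).
  by rewrite ler_pM2l ?powR_gt0.
have -> : (8 = 4 * 2 :> R)%R by lra.
rewrite powRM// expr2 -!mulrA mulKf ?gt_eqF// mulrCA ler_pM2l// ler_pM2l ?powR_gt0//.
rewrite -powRM ?(ltW r0)//; apply: ge0_ler_powR; rewrite ?nnegrE ?(ltW a0)//; lra.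
Qed.

Lemma ahlfors_hausdorff : exists2 K : R, (0 < K)%R &
  ahlfors_upto a 1 K F (hausdorff_measure a).
Proof.
pose K1 : R := (C ^+ 2 * 2 `^ a)%R; pose K2 : R := (C ^+ 2 * 8 `^ a)%R.
have K10 : (0 < K1)%R by rewrite mulr_gt0 ?exprn_gt0 ?powR_gt0.
have K20 : (0 < K2)%R by rewrite mulr_gt0 ?exprn_gt0 ?powR_gt0.
exists (K1 + K2)%R; first by rewrite addr_gt0.
move=> x r Fx r01; have /andP[r0 r1] := r01; apply/andP; split; last first.
  apply: (le_trans (hausdorff_upper Fx r01)).
  by rewrite lee_fin ler_wpM2r ?powR_ge0// lerDr ltW.
apply: (@le_trans _ _ (K1^-1 * r `^ a)%:E).
  by rewrite lee_fin ler_wpM2r ?powR_ge0// lef_pV2 ?posrE ?addr_gt0// lerDl ltW.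
rewrite EFinM lee_pdivrMl// /K1 expr2 -mulrA EFinM -muleA -lee_pdivrMl//.
have mFb : measurable (F `&` ball x r : set (borel T)).
  by apply: measurableI => //; exact: borel_measurable_ball.
have nuU (y : T) (t : R) : F y -> (0 < t < 1)%R -> nu (F `&` ball y t) <= (C * t `^ a)%:E.
  by move=> Fy /(nuF Fy)/andP[].
apply: le_trans (mass_distribution a0 C0 mF nuU mFb (@subIsetl _ _ _)).
by rewrite -EFinM; have /andP[] := nuF Fx r01.
Qed.

End hausdorff_ahlfors.

(** * From small scales to all bounded scales *)

Section euclidean_cover.
Context {R : realType} {n : nat}.

(** Pigeonhole on a cubical grid whose cells have diameter less than [delta]: the
    number of cells that meet a ball of radius [rho] does not depend on its
    centre. *)
Lemma euclidean_separated_size (rho delta : R) : 0 < rho -> 0 < delta ->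
  exists N : nat, forall (x : euclidean R n) (s : seq (euclidean R n)),
    (forall y, y \in s -> ball x rho y) -> separated_seq delta s -> (size s <= N)%N.
Proof.
move=> rho0 d0; pose eta := delta / n.+1%:R.
have eta0 : 0 < eta by rewrite divr_gt0.
pose m := Num.truncn (2 * rho / eta).
exists #|{ffun 'I_n -> 'I_m.+1}| => x s sx ss.
pose t (y : euclidean R n) (i : 'I_n) := (y ord0 i - x ord0 i + rho) / eta.
pose cell y : {ffun 'I_n -> 'I_m.+1} := [ffun i => inord (Num.truncn (t y i))].
have tP y i : y \in s -> 0 <= t y i /\ (Num.truncn (t y i) < m.+1)%N.
  move=> /sx; rewrite ballEmdist/= => /(le_lt_trans (coord_le_mdist x y i)).
  rewrite ltr_norml => /andP[h1 h2].
  have t0 : 0 <= t y i by rewrite divr_ge0 ?(ltW eta0)//; lra.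
  split => //; rewrite ltnS; apply: le_truncn.
  rewrite ler_pM2r ?invr_gt0//; lra.
have cellP y z : y \in s -> z \in s -> cell y = cell z -> mdist y z < delta.
  move=> ys zs /ffunP yz; apply: mdist_lt_coord => // i.
  have [ty0 tym] := tP y i ys; have [tz0 tzm] := tP z i zs.
  have /(congr1 val) := yz i; rewrite !ffunE /= !inordK// => k.
  have := truncn_itv ty0; have := truncn_itv tz0; rewrite k => /andP[l1 l2] /andP[l3 l4].
  have -> : y ord0 i - z ord0 i = (t y i - t z i) * eta.
    by rewrite /t -mulrBl mulfVK ?gt_eqF//; ring.
  rewrite -/eta normrM (gtr0_norm eta0) ger_pMl// ler_norml.
  move: l1 l2 l3 l4; rewrite -natr1 => *; lra.
have us : uniq (map cell s).
  rewrite uniq_pairwise pairwise_map.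
  apply: (sub_in_pairwise _ (allss s)) ss => y z ys zs yz.
  by apply/negP => /eqP /(cellP _ _ ys zs); rewrite ltNge yz.
by rewrite -(size_map cell) -(card_uniqP us) max_card.
Qed.

Lemma euclidean_ball_cover (rho delta : R) : 0 < rho -> 0 < delta ->
  exists N : nat, forall (F : set (euclidean R n)) (x : euclidean R n),
    exists s : seq (euclidean R n), [/\ (size s <= N)%N, forall y, y \in s -> F y &
      F `&` ball x rho `<=` \bigcup_(y in [set` s]) ball y delta].
Proof.
move=> rho0 d0; have [N NP] := euclidean_separated_size rho0 d0.
exists N => F x.
have sN s : (forall y, y \in s -> (F `&` ball x rho) y) -> separated_seq delta s ->
    (size s <= N)%N.
  by move=> sF; apply: (NP x) => y /sF[].
have [s [sF ss Fs]] := separated_net sN.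
by exists s; split => //; [exact: sN|move=> y /sF[]].
Qed.

End euclidean_cover.

Lemma measure_bigcup_ball_le (R : realType) (T : pmetricType R) (F : set T)
    (mu : {measure set (borel T) -> \bar R}) (delta c : R) (s : seq T) :
  measurable (F : set (borel T)) ->
  (forall y, y \in s -> mu (F `&` ball y delta) <= c%:E)%E ->
  (mu (F `&` \bigcup_(y in [set` s]) ball y delta) <= ((size s)%:R * c)%:E)%E.
Proof.
move=> mF; elim: s => [|x s ih] cs.
  rewrite mul0r (_ : _ `&` _ = set0) ?measure0//.
  by rewrite -subset0 => y [_ []].
rewrite bigcup_ball_cons setIUr.
apply: (le_trans (measureU2 _ _ _)).
- by apply: measurableI => //; exact: borel_measurable_ball.
- by apply: measurableI => //; exact: measurable_bigcup_ball.
rewrite -natr1 mulrDl mul1r [X in X%:E]addrC EFinD leeD//.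
  by apply: cs; rewrite inE eqxx.
by apply: ih => // z zs; apply: cs; rewrite inE zs orbT.
Qed.

(** Between scales [1] and [rho] the factor [r `^ a] stays between positive
    constants. The lower bound is then that of the ball of radius [1/2]; for the
    upper bound, the ball is covered by a number of balls of radius [1/2] that is
    bounded because the ambient space is Euclidean. *)
Lemma ahlfors_all_scales (R : realType) (n : nat) (a K rho : R)
    (F : set (euclidean R n)) (mu : {measure set (borel (euclidean R n)) -> \bar R}) :
  0 < a -> 0 < K -> 1 <= rho -> measurable (F : set (borel (euclidean R n))) ->
  ahlfors_upto a 1 K F mu -> exists2 K' : R, 0 < K' & ahlfors_upto a rho K' F mu.
Proof.
move=> a0 K0 rho1 mF muF; have rho0 : 0 < rho by exact: lt_le_trans rho1.
have h0 : 0 < 2^-1 :> R by rewrite invr_gt0.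
have [N NP] := @euclidean_ball_cover R n _ _ rho0 h0.
(* K1 serves the lower bound and K2 the upper bound for the radii at least 1. *)
pose K1 := K * (2 * rho) `^ a; pose K2 := N%:R * K.
have K10 : 0 < K1 by rewrite mulr_gt0 ?powR_gt0 ?mulr_gt0.
have K20 : 0 <= K2 by rewrite mulr_ge0 ?(ltW K0).
have mFb (x : euclidean R n) r : measurable (F `&` ball x r : set (borel (euclidean R n))).
  by apply: measurableI => //; exact: borel_measurable_ball.
have [K1E K2E] : K1 = K * (2 * rho) `^ a /\ K2 = N%:R * K by [].
clearbody K1 K2; exists (K + K1 + K2); first lra.
move=> x r Fx /andP[r0 rrho].
have weaken (k : R) : 0 < k -> k <= K + K1 + K2 ->
    (K + K1 + K2)^-1 * r `^ a <= k^-1 * r `^ a /\ k * r `^ a <= (K + K1 + K2) * r `^ a.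
  move=> k0 kK; rewrite !ler_wpM2r ?powR_ge0// lef_pV2 ?posrE//.
  exact: lt_le_trans kK.
have [r1|r1] := ltP r 1.
  have [|l u] := weaken K K0; first lra.
  have : 0 < r < 1 by rewrite r0.
  move=> /(muF _ _ Fx)/andP[kl ku]; apply/andP; split.
    by apply: le_trans kl; rewrite lee_fin.
  by apply: (le_trans ku); rewrite lee_fin.
have h1 : 0 < (2^-1 : R) < 1 by rewrite invr_gt0 ltr0n/= invf_lt1// ltr1n.
apply/andP; split.
  have [|l _] := weaken K1 K10; first lra.
  have /andP[+ _] := muF _ _ Fx h1.
  move=> /le_trans /(_ (_ : _ <= mu (F `&` ball x r))%E) mh.
  apply: le_trans (mh _); last first.
    apply: le_measure; rewrite ?inE//; apply: setIS; apply: le_ball.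
    by apply: le_trans r1; rewrite invf_le1// ler1n.
  rewrite lee_fin (le_trans l)// K1E invfM -mulrA ler_pM2l ?invr_gt0//.
  rewrite mulrC ler_pdivrMr ?powR_gt0 ?mulr_gt0// -powRM ?mulr_ge0 ?(ltW rho0) ?(ltW h0)//.
  by rewrite mulrA mulVf// mul1r; apply: ge0_ler_powR; rewrite ?nnegrE ?(ltW _)//.
have [s [sN sF Fs]] := NP F x.
apply: (@le_trans _ _ (mu (F `&` \bigcup_(y in [set` s]) ball y 2^-1))).
  apply: le_measure; rewrite ?inE//.
    by apply: measurableI => //; exact: measurable_bigcup_ball.
  move=> y [Fy xy]; split=> //; apply: Fs; split=> //.
  by apply: le_ball xy; exact: ltW.
apply: (le_trans (@measure_bigcup_ball_le R _ F mu 2^-1 (K * 2^-1 `^ a) s mF _)).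
  by move=> y /sF Fy; have /andP[] := muF _ _ Fy h1.
have K2r : K2 * 2^-1 `^ a <= (K + K1 + K2) * r `^ a.
  apply: ler_pM; rewrite ?powR_ge0//; first lra.
  apply: ge0_ler_powR; rewrite ?nnegrE ?(ltW a0) ?(ltW r0) ?(ltW h0)//.
  by apply: le_trans r1; rewrite invf_le1// ler1n.
rewrite lee_fin (le_trans _ K2r)// K2E -mulrA ler_wpM2r ?ler_nat//.
by rewrite mulr_ge0 ?powR_ge0 ?(ltW K0).
Qed.

(** A ball of radius [r] in [B] lies between the images of balls of radii [r / L]
    and [L * r] in [A]; hence the range of scales needed on [A]. *)
Lemma ahlfors_lipschitz_image (R : realType) (X Y : pmetricType R) (a L K rho : R)
    (A : set X) (B : set Y) f g : 0 < a -> 1 <= L -> 0 < K ->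
  bilipschitz_inverses L A B f g ->
  ahlfors_upto a (L * rho) K A (hausdorff_measure a) ->
  ahlfors_upto a rho (K * (L ^+ 2) `^ a) B (hausdorff_measure a).
Proof.
move=> a0 L1 K0 [fP gP Lf Lg] HA y r By /andP[r0 rrho].
have L0 : 0 < L by exact: lt_le_trans L1.
have [Agy fgy] := gP _ By.
have Ln : 0 <= L by exact: ltW.
apply/andP; split.
  have rL : 0 < r / L < L * rho.
    rewrite divr_gt0//= ltr_pdivrMr// (lt_le_trans rrho)// mulrC mulrA ler_peMl//.
      by rewrite (le_trans (ltW r0))// ltW.
    by rewrite mulr_ege1.
  have /andP[lo _] := HA _ _ Agy rL.
  pose D := A `&` ball (g y) (r / L).
  have fD : f @` D `<=` B `&` ball y r.
    move=> _ [x [Ax gyx] <-]; have [Bfx _] := fP _ Ax; split => //.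
    rewrite ballEmdist/= -{1}fgy (le_lt_trans (Lf _ _ Agy Ax))// mulrC -ltr_pdivlMr//.
    by move: gyx; rewrite ballEmdist.
  have gfD : g @` (f @` D) = D.
    apply/seteqP; split => [_ [_ [x [Ax Dx] <-] <-]|x [Ax Dx]].
      by have [_ ->] := fP _ Ax.
    by exists (f x); [exists x|have [] := fP _ Ax].
  have Lgf : lipschitz_within L (f @` D) g.
    by apply: lipschitz_withinS Lg => z /fD[].
  have := hausdorff_measure_lipschitz L0 (ltW a0) Lgf.
  rewrite gfD => /(le_trans lo) h.
  apply: le_trans (le_outer_measure (hausdorff_measure a) _ _ fD).
  rewrite -(@lee_pmul2l _ (L `^ a)%:E) ?lte_fin ?powR_gt0//.
  apply: le_trans h; rewrite -EFinM lee_fin.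
  have -> : r `^ a = L `^ a * (r / L) `^ a.
    by rewrite -powRM ?divr_ge0 ?(ltW r0)// mulrC mulfVK ?gt_eqF.
  have La0 : L `^ a != 0 by rewrite gt_eqF ?powR_gt0.
  rewrite expr2 powRM// le_eqVlt; apply/orP; left; apply/eqP.
  by field; rewrite La0 gt_eqF.
apply: (@le_trans _ _ (hausdorff_measure a (f @` (A `&` ball (g y) (L * r))))).
  apply: le_outer_measure => z [Bz yz]; have [Agz fgz] := gP _ Bz.
  exists (g z) => //; split => //; rewrite ballEmdist/=.
  rewrite (le_lt_trans (Lg _ _ By Bz))// ltr_pM2l//.
  by move: yz; rewrite ballEmdist.
apply: (le_trans (hausdorff_measure_lipschitz L0 (ltW a0) _)).
  by apply: lipschitz_withinS Lf => z [].
have Lr : 0 < L * r < L * rho by rewrite mulr_gt0//= ltr_pM2l.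
have /andP[_ up] := HA _ _ Agy Lr.
rewrite -lee_pdivlMl ?powR_gt0//; apply: (le_trans up); rewrite -EFinM lee_fin.
rewrite ler_pdivlMl ?powR_gt0// (powRM _ _ (ltW r0))// expr2 powRM//.
by rewrite le_eqVlt; apply/orP; left; apply/eqP; ring.
Qed.

(** * Tonelli's theorem and change of variables *)

Local Open Scope ereal_scope.

Lemma integral_mrestr d (T : measurableType d) (R : realType)
    (mu : {measure set T -> \bar R}) (D : set T) (mD : measurable D) (f : T -> \bar R) :
  measurable_fun setT f -> (forall x, 0 <= f x) ->
  \int[mrestr mu mD]_x f x = \int[mu]_(x in D) f x.
Proof.
move=> mf f0; have mCD := measurableC mD.
rewrite -(setUv D) ge0_integral_setU//; last 2 first.
- by rewrite setUv.
- by rewrite disj_set2E; apply/eqP; rewrite setICr.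
rewrite (eq_measure_integral (D := D) mu); last first.
  by move=> A _ AD; rewrite /= /mrestr setIidl.
rewrite (eq_measure_integral (D := ~` D) mzero); last first.
  move=> A _ AD; rewrite /= /mrestr /mzero (_ : A `&` D = set0) ?measure0//.
  by rewrite -subset0 => x [/AD].
by rewrite integral_measure_zero adde0.
Qed.

(** Tonelli's theorem for integrals over a set on which the measure is
    sigma-finite: Hausdorff measure itself need not be sigma-finite on the
    whole space. *)
Section tonelli_on.
Context d (T : measurableType d) (R : realType).
Variables (mu : {measure set T -> \bar R}) (D : set T) (mD : measurable D).
Hypothesis sf : sigma_finite D mu.

Let m := mrestr mu mD.
HB.instance Definition _ := Measure.on m.

Let sfm : sigma_finite setT m.
Proof.
case: sf => G DG Gfin; exists (fun i => G i `|` ~` D).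
  by rewrite bigcupUl// -DG setUv.
move=> i; have [mG Goo] := Gfin i; split; first exact/measurableU/measurableC.
apply: le_lt_trans Goo; rewrite /m /mrestr setIUl setICl setU0.
by apply: le_measure; rewrite ?inE//; exact: measurableI.
Qed.

HB.instance Definition _ := Measure_isSigmaFinite.Build _ _ _ m sfm.

Let integral_m (g : T -> \bar R) : measurable_fun setT g -> (forall x, 0 <= g x) ->
  \int[m]_x g x = \int[mu]_(x in D) g x.
Proof. exact: integral_mrestr. Qed.

Variable f : T * T -> \bar R.
Hypotheses (mf : measurable_fun setT f) (f0 : forall z, 0 <= f z).

Let mf1 x : measurable_fun setT (fun y => f (x, y)).
Proof. exact: measurableT_comp. Qed.

Let mf2 y : measurable_fun setT (fun x => f (x, y)).
Proof. exact: measurableT_comp. Qed.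

Lemma measurable_integral_on :
  measurable_fun setT (fun x => \int[mu]_(y in D) f (x, y)).
Proof.
have := @measurable_fun_fubini_tonelli_F _ _ T T R m f mf f0.
by apply: eq_measurable_fun => x _; rewrite /fubini_F integral_m.
Qed.

Lemma tonelli_on :
  \int[mu]_(x in D) \int[mu]_(y in D) f (x, y) =
  \int[mu]_(y in D) \int[mu]_(x in D) f (x, y).
Proof.
have intF : (fun x => \int[m]_y f (x, y)) = (fun x => \int[mu]_(y in D) f (x, y)).
  by apply/funext => x; rewrite integral_m.
have intG : (fun y => \int[m]_x f (x, y)) = (fun y => \int[mu]_(x in D) f (x, y)).
  by apply/funext => y; rewrite integral_m.
have := @fubini_tonelli _ _ T T R m m f mf f0; rewrite /= intF intG.
have mG : measurable_fun setT (fun y => \int[mu]_(x in D) f (x, y)).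
  by rewrite -intG; exact: (@measurable_fun_fubini_tonelli_G _ _ T T R m f mf f0).
rewrite (integral_m measurable_integral_on) ?(integral_m mG)// => z;
  exact: integral_ge0.
Qed.

End tonelli_on.

(** The domination is an inequality between [nu] and [c] times the image measure
    of [mu] by [f], once both measures are restricted and [f] is extended by a
    constant outside [A] so that the image measure is defined. *)
Lemma ge0_integral_le_image d d' (X : measurableType d) (Y : measurableType d')
    (R : realType) (mu : {measure set X -> \bar R}) (nu : {measure set Y -> \bar R})
    (A : set X) (B : set Y) (f : X -> Y) (c : {nonneg R}) (k : Y -> \bar R) :
  measurable A -> measurable B -> measurable_fun A f ->
  (forall x, A x -> B (f x)) ->
  (forall S, measurable S -> S `<=` B -> nu S <= c%:num%:E * mu (A `&` f @^-1` S)) ->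
  measurable_fun B k -> (forall y, B y -> 0 <= k y) ->
  \int[nu]_(y in B) k y <= c%:num%:E * \int[mu]_(x in A) k (f x).
Proof.
move=> mA mB mf AB dom mk k0.
have mphi : measurable_fun setT (f \_ A) := (measurable_restrictT f mA).1 mf.
have mkB : measurable_fun setT (k \_ B) := (measurable_restrictT k mB).1 mk.
have kB0 y : 0 <= (k \_ B) y by exact: erestrict_ge0.
have -> : \int[nu]_(y in B) k y = \int[mrestr nu mB]_y (k \_ B) y.
  rewrite integral_mrestr//; apply: eq_integral => y yB.
  by rewrite patchE yB.
apply: le_trans (@ge0_le_measure_integral _ _ _ _ (mscale c (pushforward (mrestr mu mA) (f \_ A))) _ _ _ measurableT kB0 mkB) _.
  move=> S mS; rewrite /= /mscale/= /pushforward /mrestr.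
  have mSB : measurable (S `&` B) by exact: measurableI.
  apply: (le_trans (dom _ mSB (@subIsetr _ _ _))).
  apply: lee_wpmul2l => //.
  rewrite (_ : A `&` _ = (f \_ A) @^-1` S `&` A)//.
  apply/seteqP; split => x /=.
    by move=> [Ax [Sfx _]]; split => //; rewrite patchE mem_set.
  by rewrite patchE => -[+ Ax]; rewrite mem_set// => Sfx; split=> //; split=> //; exact: AB.
rewrite ge0_integral_mscale//; apply: lee_wpmul2l => //.
rewrite ge0_integral_pushforward// preimage_setT integral_mrestr; last 2 first.
- exact: (measurableT_comp mkB mphi).
- by move=> x; exact: kB0.
rewrite le_eqVlt; apply/orP; left; apply/eqP; apply: eq_integral => x xA.
by rewrite /= !patchE xA mem_set//; apply: AB; rewrite inE in xA.
Qed.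

Section euclidean_measurable.
Context {R : realType} {n : nat}.
Local Notation E := (euclidean R n).

Lemma measurable_coord (i : 'I_n) :
  measurable_fun [set: borel E] ((fun x => (x : E) ord0 i) : borel E -> R).
Proof.
apply: (measurability _ (RGenOInfty.measurableE R)) => // _ [_ [a ->] <-]; rewrite setTI; apply: sub_sigma_algebra => /=.
have -> : (fun x : borel E => (x : E) ord0 i) @^-1` `]a, +oo[%classic =
    interior [set x : E | (a < x ord0 i)%R].
  apply/seteqP; split => x /=; last by move=> /interior_subset/=; rewrite in_itv/= andbT.
  rewrite in_itv/= andbT => ax; apply/nbhs_ballP.
  exists (x ord0 i - a)%R; rewrite /= ?subr_gt0// => y; rewrite ballEmdist/=.
  by move=> /(le_lt_trans (coord_le_mdist x y i)); rewrite ltr_norml => /andP[_]; lra.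
exact: open_interior.
Qed.

(** Measurability for the product sigma-algebra, which Tonelli's theorem needs,
    is read off the coordinate formula for the metric. *)
Lemma measurable_mdist : measurable_fun [set: (borel E * borel E)%type]
  ((fun z => mdist (z.1 : E) (z.2 : E)) : borel E * borel E -> R).
Proof.
have msqrt : measurable_fun setT (@Num.sqrt R).
  by apply: continuous_measurable_fun => x; exact: sqrt_continuous.
apply: (measurableT_comp msqrt); apply: measurable_sum => i.
apply: measurable_funX; apply: measurable_funB.
  exact: (measurableT_comp (measurable_coord i)).
exact: (measurableT_comp (measurable_coord i)).
Qed.

Lemma measurable_mdist_lt (r : R) :
  measurable [set z : borel E * borel E | (mdist (z.1 : E) (z.2 : E) < r)%R].
Proof.
have := measurable_mdist measurableT (measurable_itv `]-oo, r[).
rewrite setTI; congr (measurable _).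
Qed.

Lemma bounded_balls_sigma_finite (F : set E)
    (mu : {measure set (borel E) -> \bar R}) :
  measurable (F : set (borel E)) ->
  (forall r : R, (0 < r)%R -> exists K : R, forall x, F x -> mu (F `&` ball x r) <= K%:E) ->
  sigma_finite (F : set (borel E)) mu.
Proof.
move=> mF muF; have [->|/set0P[x Fx]] := eqVneq F set0.
  by exists (fun=> set0); [rewrite bigcup_const|move=> i; rewrite measure0].
exists (fun k => F `&` ball x (k.+1%:R : R)).
  rewrite -setI_bigcupr; apply/esym/setIidl => y _.
  exists (Num.truncn (mdist x y)) => //; rewrite ballEmdist/=.
  by have /andP[] := truncn_itv (mdist_ge0 x y).
move=> k; split; first by apply: measurableI => //; exact: borel_measurable_ball.
have [M hM] := muF k.+1%:R (ltr0Sn _ _).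
by rewrite (le_lt_trans (hM _ Fx))// ltry.
Qed.

End euclidean_measurable.

(** * Energy of a function at a given scale *)

(** The integral of a nonnegative function is a supremum over the simple functions
    below it, hence monotone on arbitrary functions, such as the quotients by the
    volume of a moving ball in the Besov energy. *)
Lemma le_integral_ge0 d (T : measurableType d) (R : realType)
    (mu : {measure set T -> \bar R}) (D : set T) (f1 f2 : T -> \bar R) :
  (forall x, D x -> 0 <= f1 x) -> (forall x, D x -> f1 x <= f2 x) ->
  \int[mu]_(x in D) f1 x <= \int[mu]_(x in D) f2 x.
Proof.
move=> f10 f12; have f20 x (Dx : D x) : 0 <= f2 x := le_trans (f10 x Dx) (f12 x Dx).
rewrite !ge0_integralE//; apply: ge_ereal_sup => _ [h/= hf <-].
apply: ereal_sup_ubound; exists h => // x /=; apply: (le_trans (hf x)).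
rewrite !patchE; case: ifPn => // /set_mem; exact: f12.
Qed.

Lemma ge0_integral_lincomb d (T : measurableType d) (R : realType)
    (mu : {measure set T -> \bar R}) (D : set T) (a b : R) (f g : T -> \bar R) :
  measurable D -> measurable_fun setT f -> measurable_fun setT g ->
  (0 <= a)%R -> (0 <= b)%R -> (forall x, 0 <= f x) -> (forall x, 0 <= g x) ->
  \int[mu]_(x in D) (a%:E * f x + b%:E * g x) =
  a%:E * \int[mu]_(x in D) f x + b%:E * \int[mu]_(x in D) g x.
Proof.
move=> mD mf mg a0 b0 f0 g0.
have mfD : measurable_fun D f by exact: measurable_funTS.
have mgD : measurable_fun D g by exact: measurable_funTS.
rewrite ge0_integralD//.
- by rewrite !ge0_integralZl.
- by move=> x _; rewrite mule_ge0.
- exact: measurable_funeM.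
- by move=> x _; rewrite mule_ge0.
- exact: measurable_funeM.
Qed.

Section near_energy.
Context {R : realType} {n : nat}.
Local Notation E := (euclidean R n).
Variables (A : set E) (mu : {measure set (borel E) -> \bar R}).
Hypotheses (mA : measurable (A : set (borel E))) (sA : sigma_finite (A : set (borel E)) mu).

(** The energy without its normalization by the volume of balls; for Ahlfors
    regular measures that normalization only amounts to a power of [r]. *)
Definition near_energy (u : E -> R) (r : R) : \bar R :=
  \int[mu]_(x in A) \int[mu]_(y in A `&` ball (x : E) r) (`|u x - u y| ^+ 2)%:E.

(** Turns an integral over a moving ball into an integral over the fixed set
    [A] of a function on the product, as Tonelli's theorem requires. *)
Definition near_kernel (k : E -> E -> R) (r : R) : borel E * borel E -> \bar R :=
  (fun z => (k z.1 z.2)%:E) \_ [set z | (mdist (z.1 : E) (z.2 : E) < r)%R].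

Lemma measurable_near_kernel (k : E -> E -> R) (r : R) :
  measurable_fun [set: borel E * borel E] (fun z => k z.1 z.2) ->
  measurable_fun [set: borel E * borel E] (near_kernel k r).
Proof.
move=> mk; apply: (measurable_restrictT _ (measurable_mdist_lt r)).1.
by apply: measurable_funS (measurableT_comp (@EFin_measurable _ _) mk) => //.
Qed.

Lemma near_kernel_ge0 (k : E -> E -> R) (r : R) z :
  (forall x y, 0 <= k x y)%R -> 0 <= near_kernel k r z.
Proof. by move=> k0; apply: erestrict_ge0 => x _; rewrite lee_fin. Qed.

Lemma integral_near_kernel (k : E -> E -> R) (r : R) (x : E) :
  \int[mu]_(y in A `&` ball x r) (k x y)%:E = \int[mu]_(y in A) near_kernel k r (x, y).
Proof.
rewrite integral_mkcondr; apply: eq_integral => y _.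
by rewrite /near_kernel !patchE.
Qed.

Let jump (v : E -> R) (x y : E) : R := (`|v x - v y| ^+ 2)%R.

Let measurable_jump (v : borel E -> R) : measurable_fun setT v ->
  measurable_fun [set: borel E * borel E] (fun z => jump v z.1 z.2).
Proof.
move=> mv; apply: measurable_funX; apply: measurableT_comp => //.
by apply: measurable_funB; apply: measurableT_comp.
Qed.

Lemma measurable_near_integral (v : borel E -> R) (r : R) : measurable_fun setT v ->
  measurable_fun [set: borel E]
    (fun x => \int[mu]_(y in A `&` ball (x : E) r) (`|v x - v y| ^+ 2)%:E).
Proof.
move=> mv.
have := @measurable_integral_on _ _ R mu A mA sA (near_kernel (jump v) r)
  (measurable_near_kernel r (measurable_jump mv)) _.
move=> /(_ (fun z => near_kernel_ge0 r z (fun x y => sqr_ge0 _))).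
by apply: eq_measurable_fun => x _; rewrite -integral_near_kernel.
Qed.

Lemma eq_near_energy (u v : E -> R) (r : R) : (forall x, A x -> u x = v x) ->
  near_energy u r = near_energy v r.
Proof.
move=> uv; apply: eq_integral => x /set_mem Ax; apply: eq_integral => y /set_mem[Ay _].
by rewrite !uv.
Qed.

Lemma near_energy_le_average (u : borel E -> R) (r q : R) : measurable_fun setT u ->
  (0 < q)%R -> (forall x, A x -> mu (A `&` ball x r) <= q%:E) ->
  near_energy u r <= q%:E *
    \int[mu]_(x in A) ((mu (A `&` ball (x : E) r))^-1 *
      \int[mu]_(y in A `&` ball (x : E) r) (`|u x - u y| ^+ 2)%:E).
Proof.
move=> mu_u q0 Vq; rewrite -lee_pdivrMl//.
rewrite -ge0_integralZl//; last 3 first.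
- exact: measurable_funTS (measurable_near_integral r mu_u).
- by move=> x _; apply: integral_ge0 => y _; rewrite lee_fin sqr_ge0.
- by rewrite lee_fin invr_ge0 ltW.
apply: le_integral_ge0 => x Ax.
  apply: mule_ge0; first by rewrite lee_fin invr_ge0 ltW.
  by apply: integral_ge0 => y _; rewrite lee_fin sqr_ge0.
apply: lee_wpmul2r; first by apply: integral_ge0 => y _; rewrite lee_fin sqr_ge0.
have -> : (q^-1)%:E = (q%:E)^-1 by rewrite inver gt_eqF.
by rewrite lee_pV2 ?inE ?measure_ge0 ?lee_fin ?(ltW q0)// Vq.
Qed.

(** Bound [(u x - u y)^2] by [2 (u x)^2 + 2 (u y)^2]; by Tonelli's theorem and the
    symmetry of the metric both terms integrate to the same, and in the first
    one the inner integral is the volume of a ball. *)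
Lemma near_energy_le_L2 (u : borel E -> R) (r q : R) : measurable_fun setT u ->
  (0 <= q)%R -> (forall x, A x -> mu (A `&` ball x r) <= q%:E) ->
  near_energy u r <= (4 * q)%:E * \int[mu]_(x in A) (`|u x| ^+ 2)%:E.
Proof.
move=> mu_u q0 Vq.
pose sq (x y : E) : R := (`|u x| ^+ 2)%R.
have msq : measurable_fun setT (fun x : borel E => (`|u x| ^+ 2)%R).
  by apply: measurable_funX; exact: measurableT_comp.
have msq2 : measurable_fun setT (fun x : borel E => (`|u x| ^+ 2)%:E).
  exact: measurableT_comp.
pose P := near_kernel sq r; pose Q := near_kernel (fun x y => sq y x) r.
have mP : measurable_fun setT P.
  by apply: measurable_near_kernel; exact: (measurableT_comp msq).
have mQ : measurable_fun setT Q.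
  by apply: measurable_near_kernel; exact: (measurableT_comp msq).
have P0 z : 0 <= P z by apply: near_kernel_ge0 => *; exact: sqr_ge0.
have Q0 z : 0 <= Q z by apply: near_kernel_ge0 => *; exact: sqr_ge0.
have mP1 x : measurable_fun setT (fun y => P (x, y)) by exact: measurableT_comp.
have mQ1 x : measurable_fun setT (fun y => Q (x, y)) by exact: measurableT_comp.
have mIP := measurable_integral_on mA sA mP P0.
have mIQ := measurable_integral_on mA sA mQ Q0.
have IP0 x : 0 <= \int[mu]_(y in A) P (x, y) by exact: integral_ge0.
have IQ0 x : 0 <= \int[mu]_(y in A) Q (x, y) by exact: integral_ge0.
have IP : \int[mu]_(x in A) \int[mu]_(y in A) P (x, y) <=
    q%:E * \int[mu]_(x in A) (`|u x| ^+ 2)%:E.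
  rewrite -ge0_integralZl//; last exact: measurable_funTS.
  apply: le_integral_ge0 => [x _|x Ax]; first exact: IP0.
  have mAx : measurable (A `&` ball (x : E) r : set (borel E)).
    by apply: measurableI => //; exact: borel_measurable_ball.
  rewrite -integral_near_kernel.
  have -> : \int[mu]_(y in A `&` ball (x : E) r) (sq x y)%:E =
      (`|u x| ^+ 2)%:E * mu (A `&` ball (x : E) r).
    by rewrite -(@integral_cst _ _ _ mu _ mAx).
  by rewrite muleC; apply: lee_wpmul2r; [rewrite lee_fin sqr_ge0|exact: Vq].
have IQ : \int[mu]_(x in A) \int[mu]_(y in A) Q (x, y) =
    \int[mu]_(x in A) \int[mu]_(y in A) P (x, y).
  rewrite (tonelli_on mA sA mQ Q0); apply: eq_integral => y _; apply: eq_integral => x _.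
  have Pxy : (Q (x, y) = P (y, x)).
    rewrite /P /Q /near_kernel !patchE /=.
    have -> : ((x, y) \in [set z : E * E | (mdist z.1 z.2 < r)%R]) =
              ((y, x) \in [set z : E * E | (mdist z.1 z.2 < r)%R]).
      by apply/idP/idP => /set_mem /= h; apply/mem_set => /=; rewrite metric_sym.
    by [].
  exact: Pxy.
apply: (@le_trans _ _ (\int[mu]_(x in A) (2%:E * \int[mu]_(y in A) P (x, y) +
    2%:E * \int[mu]_(y in A) Q (x, y)))).
  apply: le_integral_ge0 => x Ax; first by apply: integral_ge0 => y _; rewrite lee_fin sqr_ge0.
  rewrite (integral_near_kernel (jump u)) -(ge0_integral_lincomb mu mA (mP1 x) (mQ1 x))//.
  apply: le_integral_ge0 => y Ay.
    by apply: near_kernel_ge0 => *; exact: sqr_ge0.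
  rewrite /P /Q /near_kernel !patchE; case: ifPn => _; last by rewrite !mule0 adde0.
  rewrite -!EFinM -EFinD lee_fin /jump /sq /=.
  rewrite !real_normK ?num_real//; have := sqr_ge0 (u x + u y)%R; nra.
rewrite (ge0_integral_lincomb mu mA mIP mIQ)// IQ -ge0_muleDl ?lee_fin// -EFinD.
have -> : (4 * q)%:E = (2 + 2)%:E * q%:E by rewrite -EFinM; congr EFin; ring.
by rewrite -muleA lee_wpmul2l ?lee_fin.
Qed.

End near_energy.

(** * Transfer along a bi-Lipschitz map *)

Section bilipschitz_transfer.
Context {R : realType} {n : nat}.
Local Notation E := (euclidean R n).
Local Notation H a := (hausdorff_measure a : {measure set (borel E) -> \bar R}).
Variables (a L : R) (A B : set E) (f g : E -> E).
Hypotheses (a0 : (0 < a)%R) (L1 : (1 <= L)%R) (cA : closed A) (cB : closed B).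
Hypothesis fgP : bilipschitz_inverses L A B f g.

Let L0 : (0 < L)%R. Proof. exact: lt_le_trans L1. Qed.
Let c : {nonneg R} := NngNum (powR_ge0 L a).

Let mA : measurable (A : set (borel E)). Proof. exact: borel_measurable_closed. Qed.
Let mB : measurable (B : set (borel E)). Proof. exact: borel_measurable_closed. Qed.

Let mf : measurable_fun (A : set (borel E)) (f : borel E -> borel E).
Proof. by case: fgP => _ _ Lf _; exact: (lipschitz_measurable L0 Lf mA). Qed.

Let mg : measurable_fun (B : set (borel E)) (g : borel E -> borel E).
Proof. by case: fgP => _ _ _ Lg; exact: (lipschitz_measurable L0 Lg mB). Qed.

Let integral_le_image (k : E -> \bar R) :
  measurable_fun (B : set (borel E)) (k : borel E -> \bar R) -> (forall y, B y -> 0 <= k y) ->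
  \int[H a]_(y in B) k y <= (L `^ a)%:E * \int[H a]_(x in A) k (f x).
Proof.
move=> mk k0; apply: (@ge0_integral_le_image _ _ _ _ R (H a) (H a) A B f c k) => //.
- by case: fgP => fP _ _ _ x /fP[].
- by move=> S _ SB; exact: (hausdorff_measure_preimage_le L0 (ltW a0) fgP).
Qed.

Variable (K K' : R) (sA : sigma_finite (A : set (borel E)) (H a)).
Hypothesis (K0 : (0 < K)%R) (HA : ahlfors_upto a L K A (hausdorff_measure a)).
Hypothesis (K'0 : (0 < K')%R) (HB : ahlfors_upto a 1 K' B (hausdorff_measure a)).

Variable u : E -> R.
Hypothesis mu_u : measurable_fun (A : set (borel E)) (u : borel E -> R).

(* u is only measurable on A; Tonelli's theorem needs a function measurable on
   the whole space, and the integrals over A do not see the difference. *)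
Let v : borel E -> R := (u : borel E -> R) \_ A.
Let mv : measurable_fun setT v. Proof. exact: (measurable_restrictT _ mA).1 mu_u. Qed.
Let vu x : A x -> v x = u x. Proof. by move=> Ax; rewrite /v patchE mem_set. Qed.

Let average (D : set E) (w : E -> R) (r : R) := \int[H a]_(x in D)
  ((H a (D `&` ball (x : E) r))^-1 *
   \int[H a]_(y in D `&` ball (x : E) r) (`|w x - w y| ^+ 2)%:E).

Lemma measurable_comp_inverse :
  measurable_fun (B : set (borel E)) ((u \o g) : borel E -> R).
Proof.
have : measurable_fun (B : set (borel E)) (v \o (g : borel E -> borel E)).
  exact: measurableT_comp.
apply: eq_measurable_fun => y /set_mem By /=; case: fgP => _ /(_ _ By)[Agy _] _ _.
by rewrite vu.
Qed.

Lemma L2_comp_inverse : \int[H a]_(y in B) (`|(u \o g) y| ^+ 2)%:E <=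
  (L `^ a)%:E * \int[H a]_(x in A) (`|u x| ^+ 2)%:E.
Proof.
have fK x : A x -> g (f x) = x by case: fgP => fP _ _ _ /fP[].
rewrite [X in _ * X](eq_integral (fun x : borel E => (`|(u \o g) (f x)| ^+ 2)%:E)); last first.
  by move=> x /set_mem Ax; rewrite /= fK.
apply: (integral_le_image (k := fun y => (`|(u \o g) y| ^+ 2)%:E)).
  apply: measurableT_comp => //; apply: measurable_funX; apply: measurableT_comp => //.
  exact: measurable_comp_inverse.
by move=> y _; rewrite lee_fin sqr_ge0.
Qed.

(** The volumes in [B] are at least of order [r `^ a], and a ball of radius [r] in
    [B] is the image of a subset of a ball of radius [L * r] in [A]; each of the
    two integrals costs a factor [L `^ a]. *)
Lemma average_comp_inverse (r : R) : (0 < r < 1)%R ->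
  average B (u \o g) r <=
  ((L `^ a) ^+ 2 * (K' * r `^ (- a)))%:E * near_energy A (H a) u (L * r).
Proof.
move=> r01; have /andP[r0 r1] := r01; case: (fgP) => fP gP Lf Lg.
pose J (x : E) := \int[H a]_(y in A `&` ball (x : E) (L * r)) (`|v x - v y| ^+ 2)%:E.
have mJ : measurable_fun setT (J : borel E -> \bar R) by exact: measurable_near_integral.
have J0 x : 0 <= J x by apply: integral_ge0 => y _; rewrite lee_fin sqr_ge0.
pose q := (K' * r `^ (- a))%R.
have q0 : (0 <= q)%R by rewrite mulr_ge0 ?powR_ge0 ?ltW.
have Vq y : B y -> (H a (B `&` ball y r))^-1 <= q%:E.
  move=> By; have /andP[lo _] := HB By r01.
  rewrite inve_ple ?inE ?measure_ge0 ?lee_fin//.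
  rewrite inver gt_eqF ?mulr_gt0 ?powR_gt0//.
  by rewrite /q invfM powRN invrK.
have inner y : B y ->
    \int[H a]_(z in B `&` ball y r) (`|(u \o g) y - (u \o g) z| ^+ 2)%:E <=
    (L `^ a)%:E * J (g y).
  move=> By; have [Agy fgy] := gP _ By.
  pose k : borel E -> \bar R := (fun z : borel E => (`|v (g y) - (u \o g) z| ^+ 2)%:E) \_ (ball y r).
  have mk : measurable_fun (B : set (borel E)) k.
    apply: (measurable_restrict _ _ mB).1; first exact: borel_measurable_ball.
    apply: measurableT_comp => //; apply: measurable_funX; apply: measurableT_comp => //.
    apply: measurable_funB => //; apply: measurable_funS measurable_comp_inverse => //.
  have k0 z : B z -> 0 <= k z.
    by move=> _; apply: erestrict_ge0 => w _; rewrite lee_fin sqr_ge0.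
  rewrite integral_mkcondr (eq_integral k); last first.
    by move=> z _; rewrite /k /= vu.
  apply: (le_trans (integral_le_image mk k0)).
  apply: lee_wpmul2l; first by rewrite lee_fin powR_ge0.
  rewrite /J [leRHS]integral_mkcondr; apply: le_integral_ge0.
    by move=> x /fP[/k0].
  move=> x Ax; have [Bfx gfx] := fP _ Ax.
  rewrite /k !patchE; case: ifPn => [/set_mem yfx|_]; last first.
    by case: ifPn => // _; rewrite lee_fin sqr_ge0.
  rewrite mem_set; first by rewrite /= gfx (vu Ax).
  move: yfx; rewrite !ballEmdist/= => yfx.
  by rewrite -{1}gfx (le_lt_trans (Lg _ _ By Bfx))// ltr_pM2l.
apply: (@le_trans _ _ (\int[H a]_(y in B) ((q * L `^ a)%:E * J (g y)))).
  apply: le_integral_ge0 => y By.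
    by rewrite mule_ge0 ?inve_ge0 ?measure_ge0//; apply: integral_ge0 => z _; rewrite lee_fin sqr_ge0.
  rewrite EFinM -muleA; apply: lee_pmul; rewrite ?inve_ge0 ?measure_ge0 ?Vq ?inner//.
  by apply: integral_ge0 => z _; rewrite lee_fin sqr_ge0.
have mJg : measurable_fun (B : set (borel E)) ((J \o g) : borel E -> \bar R).
  exact: (measurableT_comp mJ mg).
apply: (le_trans (integral_le_image (k := fun y => (q * L `^ a)%:E * J (g y)) _ _)).
- exact: measurable_funeM.
- by move=> y _; apply: mule_ge0; [rewrite lee_fin mulr_ge0 ?powR_ge0|exact: J0].
rewrite (eq_integral (fun x : borel E => (q * L `^ a)%:E * J x)); last first.
  by move=> x /set_mem Ax; have [_ ->] := fP _ Ax.
rewrite ge0_integralZl//; last 2 first.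
- exact: measurable_funTS.
- by rewrite lee_fin mulr_ge0 ?powR_ge0.
rewrite muleA -EFinM (@eq_near_energy _ _ A (H a) u v); last by move=> x /vu.
have -> : (L `^ a * (q * L `^ a) = (L `^ a) ^+ 2 * (K' * r `^ (- a)))%R by rewrite /q; ring.
exact: lexx.
Qed.

Let near_le (r : R) : (0 < r < 1)%R -> forall x, A x ->
  H a (A `&` ball x (L * r)) <= (K * (L * r) `^ a)%:E.
Proof.
move=> /andP[r0 r1] x Ax.
have Lr : (0 < L * r < L)%R by rewrite mulr_gt0//= -[ltRHS]mulr1 ltr_pM2l.
by have /andP[] := HA Ax Lr.
Qed.

(** The energy of [u \o g] at scale [r] is controlled by that of [u] at scale
    [L * r] while this is below 1. For larger [r], which is then at least
    [L^-1], it is controlled by the L2 norm of [u]. *)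
Lemma besov_comp_inverse (sigma : R) : (0 < sigma)%R -> besov A (H a) sigma u ->
  besov B (H a) sigma (u \o g).
Proof.
move=> sigma0 [_ u2 uW]; split.
- exact: measurable_comp_inverse.
- by rewrite (le_lt_trans L2_comp_inverse)// lte_mul_pinfty ?lee_fin ?powR_ge0.
set W := besov_energy _ _ _ _ in uW; set N := \int[_]_(_ in _) _ in u2.
have N0 : 0 <= N by apply: integral_ge0 => x _; rewrite lee_fin sqr_ge0.
have avg0 (D : set E) w r : 0 <= average D w r.
  apply: integral_ge0 => x _; rewrite mule_ge0 ?inve_ge0 ?measure_ge0//.
  by apply: integral_ge0 => y _; rewrite lee_fin sqr_ge0.
have leW r : (0 < r < 1)%R -> (r `^ (- (2 * sigma)))%:E * average A u r <= W.
  by move=> r01; apply: ereal_sup_ubound; exists r.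
have W0 : 0 <= W.
  have h1 : (0 < (2^-1 : R) < 1)%R by rewrite invr_gt0 ltr0n/= invf_lt1// ltr1n.
  by apply: le_trans (leW _ h1); rewrite mule_ge0// lee_fin powR_ge0.
(* What remains of the constants once the powers of r have cancelled; in the case
   1 <= L * r, the factor r `^ (- (2 * sigma)) is bounded by L `^ (2 * sigma). *)
pose C := ((L `^ a) ^+ 2 * K' * K * L `^ a * L `^ (2 * sigma))%R.
have C0 : (0 <= C)%R by rewrite !mulr_ge0 ?powR_ge0 ?exprn_ge0 ?(ltW K0) ?(ltW K'0).
have CW0 : 0 <= C%:E * W by rewrite mule_ge0.
have CN0 : 0 <= (4 * C)%:E * N by rewrite mule_ge0// lee_fin mulr_ge0.
apply: (@le_lt_trans _ _ (C%:E * W + (4 * C)%:E * N)); last first.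
  by rewrite lte_add_pinfty// lte_mul_pinfty// lee_fin mulr_ge0.
apply: ge_ereal_sup => _ [r r01 <-]; have /andP[r0 r1] := r01.
have Lr0 : (0 < L * r)%R by rewrite mulr_gt0.
pose b := ((L `^ a) ^+ 2 * (K' * r `^ (- a)))%R.
pose t := (r `^ (- (2 * sigma)))%R.
have b0 : (0 <= b)%R by rewrite !mulr_ge0 ?powR_ge0 ?exprn_ge0 ?(ltW K'0).
have t0 : (0 <= t)%R by exact: powR_ge0.
have La : (b * (K * (L * r) `^ a) = (L `^ a) ^+ 2 * K' * K * L `^ a)%R.
  rewrite /b powRN powRM ?(ltW L0) ?(ltW r0)//.
  by field; rewrite gt_eqF ?powR_gt0.
apply: (@le_trans _ _ (t%:E * (b%:E * near_energy A (H a) u (L * r)))).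
  by apply: lee_wpmul2l; rewrite ?lee_fin//; exact: average_comp_inverse.
rewrite (@eq_near_energy _ _ A (H a) u v); last by move=> x /vu.
have Kr0 : (0 < K * (L * r) `^ a)%R by rewrite mulr_gt0 ?powR_gt0.
have [Lr1|Lr1] := ltP (L * r)%R 1%R.
  apply: (@le_trans _ _ (C%:E * W)); last by rewrite leeDl.
  have := near_energy_le_average mA sA mv Kr0 (near_le r01).
  have -> : \int[H a]_(x in A) ((H a (A `&` ball (x : E) (L * r)))^-1 *
      \int[H a]_(y in A `&` ball (x : E) (L * r)) (`|v x - v y| ^+ 2)%:E) =
      average A u (L * r).
    apply: eq_integral => x /set_mem Ax; congr (_ * _).
    by apply: eq_integral => y /set_mem[Ay _]; rewrite !vu.
  move=> near_avg.
  apply: (@le_trans _ _ (t%:E * (b%:E * ((K * (L * r) `^ a)%:E * average A u (L * r))))).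
    by rewrite !lee_wpmul2l ?lee_fin.
  have Lr01 : (0 < L * r < 1)%R by rewrite Lr0.
  apply: le_trans (lee_wpmul2l _ (leW _ Lr01)); last by rewrite lee_fin.
  rewrite !muleA -!EFinM le_eqVlt; apply/orP; left; apply/eqP; congr (_%:E * _).
  rewrite /C -mulrA La /t !powRN powRM ?(ltW L0) ?(ltW r0)//.
  by field; rewrite !gt_eqF ?powR_gt0.
apply: (@le_trans _ _ ((4 * C)%:E * N)); last by rewrite leeDr.
have := near_energy_le_L2 mA sA mv (ltW Kr0) (near_le r01).
have -> : \int[H a]_(x in A) (`|v x| ^+ 2)%:E = N.
  by apply: eq_integral => x /set_mem Ax; rewrite vu.
move=> near_N.
apply: (@le_trans _ _ (t%:E * (b%:E * ((4 * (K * (L * r) `^ a))%:E * N)))).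
  by rewrite !lee_wpmul2l ?lee_fin.
rewrite !muleA -!EFinM; apply: lee_wpmul2r => //; rewrite lee_fin.
have -> : (t * b * (4 * (K * (L * r) `^ a)) =
  4 * ((L `^ a) ^+ 2 * K' * K * L `^ a) * t)%R by rewrite -La; ring.
rewrite /C -!mulrA.
do 6 (apply: ler_wpM2l; first by rewrite ?exprn_ge0 ?powR_ge0 ?(ltW K0) ?(ltW K'0)).
have s0 : (0 <= 2 * sigma)%R by rewrite mulr_ge0 ?(ltW sigma0).
rewrite /t powRN -[leLHS]mul1r ler_pdivrMr ?powR_gt0// -powRM ?(ltW L0) ?(ltW r0)//.
apply: (@le_trans _ _ (1 `^ (2 * sigma))%R); first by rewrite powR1.
apply: ge0_ler_powR; rewrite ?nnegrE ?(ltW Lr0)//.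
Qed.

(** [f] pulls negligible sets back to negligible sets. *)
Lemma nonconstant_comp_inverse : nonconstant A (H a) u ->
  nonconstant B (H a) (u \o g).
Proof.
move=> ncu [l [Z [mZ Z0 BZ]]]; apply: ncu; exists l.
exists (A `&` f @^-1` Z); split.
- exact: mf.
- apply/eqP; rewrite eq_le measure_ge0 andbT.
  have AZ : A `&` f @^-1` Z `<=` A by move=> x [].
  apply: (le_trans (hausdorff_measure_preimage_le L0 (ltW a0) (bilipschitz_inverses_sym fgP) AZ)).
  rewrite (_ : hausdorff_measure a _ = 0) ?mule0//.
  apply/eqP; rewrite eq_le outer_measure_ge0 andbT -Z0.
  apply: le_outer_measure => y [By [Agy]] /=.
  by case: fgP => _ /(_ _ By)[_ ->].
- move=> x /= /not_implyP[Ax ux]; split => //; apply: BZ => /=.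
  case: fgP => /(_ _ Ax)[Bfx gfx] _ _ _ /(_ Bfx).
  by rewrite gfx.
Qed.

End bilipschitz_transfer.

Lemma le_critical_exponent (R : realType) (n : nat) (a L K K' : R)
    (A B : set (euclidean R n)) (f g : euclidean R n -> euclidean R n) :
  (0 < a)%R -> (1 <= L)%R -> closed A -> closed B ->
  bilipschitz_inverses L A B f g ->
  sigma_finite (A : set (borel (euclidean R n))) (hausdorff_measure a) ->
  (0 < K)%R -> ahlfors_upto a L K A (hausdorff_measure a) ->
  (0 < K')%R -> ahlfors_upto a 1 K' B (hausdorff_measure a) ->
  critical_exponent A (hausdorff_measure a) <= critical_exponent B (hausdorff_measure a).
Proof.
move=> a0 L1 cA cB fg sA K0 HA K'0 HB.
apply: lee_wpmul2l; first by rewrite lee_fin.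
apply: ge_ereal_sup => _ [sigma [s0 [u [Bu ncu]]] <-].
apply: ereal_sup_ubound; exists sigma => //; split => //; exists (u \o g); split.
- have [mu_u _ _] := Bu.
  exact: (besov_comp_inverse a0 L1 cA cB fg sA K0 HA K'0 HB mu_u s0 Bu).
- exact: (nonconstant_comp_inverse a0 L1 cA fg ncu).
Qed.

Lemma ahlfors_hausdorff_sigma_finite (R : realType) (n : nat) (a : R)
    (A : set (euclidean R n)) : closed A ->
  (forall rho : R, (1 <= rho)%R -> exists2 K : R, (0 < K)%R &
    ahlfors_upto a rho K A (hausdorff_measure a)) ->
  sigma_finite (A : set (borel (euclidean R n))) (hausdorff_measure a).
Proof.
move=> cA HA; apply: bounded_balls_sigma_finite.
  exact: borel_measurable_closed.
move=> r r0; have [|K _ HK] := HA (r + 1)%R; first by rewrite lerDr ltW.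
exists (K * r `^ a)%R => x Ax; have r01 : (0 < r < r + 1)%R by rewrite r0 /= ltrDl ltr01.
by have /andP[] := HK _ _ Ax r01.
Qed.

Local Close Scope ereal_scope.

Theorem theorem1p1 (R : realType) (n : nat) (alpha : R)
    (F : set (euclidean R n)) (T : euclidean R n -> euclidean R n) :
  0 < alpha -> alpha <= n%:R ->
  alpha_set alpha F ->
  bi_lipschitz F (T @` F) T ->
  critical_exponent F (hausdorff_measure alpha) =
  critical_exponent (T @` F) (hausdorff_measure alpha).
Proof.
move=> a0 _ [cF [nu [C [C0 nuF]]]] /bi_lipschitz_inverse[L [S [L1 TS]]].
have L0 : 0 < L by exact: lt_le_trans L1.
have ST := bilipschitz_inverses_sym TS.
have cG : closed (T @` F) := bilipschitz_closed L0 TS cF.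
have mF := borel_measurable_closed cF.
have [K0 K00 HF0] := ahlfors_hausdorff a0 C0 mF nuF.
have HF rho : 1 <= rho -> exists2 K : R, 0 < K &
    ahlfors_upto alpha rho K F (hausdorff_measure alpha).
  by move=> rho1; exact: ahlfors_all_scales HF0.
have HG rho : 1 <= rho -> exists2 K : R, 0 < K &
    ahlfors_upto alpha rho K (T @` F) (hausdorff_measure alpha).
  move=> rho1; have [|K K0' HK] := HF (L * rho).
    by rewrite mulr_ege1.
  exists (K * (L ^+ 2) `^ alpha); first by rewrite mulr_gt0// powR_gt0// exprn_gt0.
  exact: ahlfors_lipschitz_image a0 L1 K0' TS HK.
have [KF KF0 hF] := HF _ L1; have [KG KG0 hG] := HG _ L1.
have [KF1 KF10 hF1] := HF _ (lexx 1); have [KG1 KG10 hG1] := HG _ (lexx 1).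
apply/eqP; rewrite eq_le; apply/andP; split.
- exact: le_critical_exponent L1 cF cG TS (ahlfors_hausdorff_sigma_finite cF HF) KF0 hF KG10 hG1.
- exact: le_critical_exponent L1 cG cF ST (ahlfors_hausdorff_sigma_finite cG HG) KG0 hG KF10 hF1.
Qed.
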